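(* For any graph $G$, the following are equivalent: (a) $G$ is a $(2P_3,C_4,C_6,C_7,\text{3-pentagon})$-free graph that contains no simplicial vertices; (b) $G$ contains exactly one nontrivial anticomponent, and this anticomponent is a 5-crown; (c) $G$ can be obtained from a 5-crown by possibly adding universal vertices to it.
   Context: All graphs are finite, simple, nonnull. A graph is $(H_1,\dots,H_m)$-free if it has no induced subgraph isomorphic to any $H_i$. $P_k$, $C_k$ are the path and cycle on $k$ vertices; $2P_3$ is two disjoint copies of $P_3$. The 3-pentagon is the graph on vertices $a,b_1,b_2,b_3,c_1,c_2,c_3$ where $a$ is adjacent to each $b_i$ and to no $c_i$, $\{b_1,b_2,b_3\}$ is stable, $\{c_1,c_2,c_3\}$ is a clique, and $b_ic_j$ is an edge iff $i=j$. A clique is a possibly empty set of pairwise adjacent vertices. A vertex is simplicial if its neighbours form a clique, universal if adjacent to all other vertices. For disjoint vertex sets $X,Y$, $X$ is complete to $Y$ if every vertex of $X$ is adjacent to every vertex of $Y$. An anticomponent of $G$ is a maximal induced subgraph whose complement is connected; nontrivial if it has at least two vertices. ''$G$ can be obtained from $Q$ by possibly adding universal vertices'' means $Q$ is an induced subgraph of $G$ and $V(G)\setminus V(Q)$ is a (possibly empty) clique complete to $V(Q)$. A 5-ring is a graph $R$ whose vertex set partitions into nonempty sets $X_0,\dots,X_4$ (indices mod 5) such that each $X_i$ can be ordered $u^i_1,\dots,u^i_{|X_i|}$ with $X_i\subseteq N[u^i_{|X_i|}]\subseteq\dots\subseteq N[u^i_1]=X_{i-1}\cup X_i\cup X_{i+1}$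 (closed neighbourhoods in $R$). A 5-crown is a 5-ring with such a partition $(X_0,\dots,X_4)$ for which there is $i^*\in\mathbb{Z}_5$ with $X_{i^*-1}$ complete to $X_{i^*-2}$ and $X_{i^*+1}$ complete to $X_{i^*+2}$. *)

(* Defs.v *)
From mathcomp Require Import all_boot.
Set Implicit Arguments. Unset Strict Implicit. Unset Printing Implicit Defensive.

(* A finite simple graph: vertex type T : finType, adjacency e : rel T,
   required (in the theorem) to be symmetric and irreflexive. *)

Definition has_induced (T : finType) (e : rel T) (H : finType) (h : rel H) : Prop :=
  exists f : H -> T, injective f /\ (forall x y, e (f x) (f y) = h x y).

(* P_3 + P_3 on vertices 0-1-2 and 3-4-5 *)
Definition twoP3_rel : rel 'I_6 := fun i j =>
  ((i %/ 3) == (j %/ 3)) && ((i.+1 == j :> nat) || (j.+1 == i :> nat)).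

Definition cycle_rel (k : nat) : rel 'I_k := fun i j =>
  (j == i.+1 %% k :> nat) || (i == j.+1 %% k :> nat).

(* 3-pentagon: 0 = a, 1,2,3 = b_1,b_2,b_3, 4,5,6 = c_1,c_2,c_3 *)
Definition pent3_half (i j : nat) : bool :=
  [|| (i == 0) && (1 <= j <= 3),
      [&& 4 <= i, 4 <= j & i != j]
    | (1 <= i <= 3) && (j == i + 3)].
Definition pent3_rel : rel 'I_7 := fun i j => pent3_half i j || pent3_half j i.

Definition simplicial (T : finType) (e : rel T) (v : T) : Prop :=
  forall x y, e v x -> e v y -> x != y -> e x y.

Definition corel (T : finType) (e : rel T) (A : {set T}) : rel T :=
  fun x y => [&& x \in A, y \in A, x != y & ~~ e x y].

Definition coconnected (T : finType) (e : rel T) (A : {set T}) : Prop :=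
  A != set0 /\ forall x y, x \in A -> y \in A -> connect (corel e A) x y.

Definition anticomponent (T : finType) (e : rel T) (A : {set T}) : Prop :=
  coconnected e A /\
  (forall B : {set T}, A \subset B -> coconnected e B -> B = A).

Definition sh (i : 'I_5) (k : nat) : 'I_5 := inord ((i + k) %% 5).

Definition cnbhd (T : finType) (e : rel T) (A : {set T}) (u : T) : {set T} :=
  [set w in A | (w == u) || e u w].

Definition complete_to (T : finType) (e : rel T) (X Y : {set T}) : Prop :=
  forall x y, x \in X -> y \in Y -> e x y.

Definition ring5_partition (T : finType) (e : rel T) (A : {set T})
    (X : 'I_5 -> {set T}) : Prop :=
  [/\ (forall i, X i != set0),
      (forall i j, i != j -> [disjoint X i & X j]),
      \bigcup_(i < 5) X i = A &
      (forall i, exists (u1 : T) (s : seq T),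
         [/\ uniq (u1 :: s),
             (forall x, (x \in u1 :: s) = (x \in X i)),
             sorted (fun u v => cnbhd e A v \subset cnbhd e A u) (u1 :: s),
             X i \subset cnbhd e A (last u1 s) &
             cnbhd e A u1 = X (sh i 4) :|: X i :|: X (sh i 1)])].

Definition is_5ring (T : finType) (e : rel T) (A : {set T}) : Prop :=
  exists X, ring5_partition e A X.

Definition is_5crown (T : finType) (e : rel T) (A : {set T}) : Prop :=
  exists X, ring5_partition e A X /\
    exists istar : 'I_5,
      complete_to e (X (sh istar 4)) (X (sh istar 3)) /\
      complete_to e (X (sh istar 1)) (X (sh istar 2)).

(* Main.v *)
Require Import Defs.
From mathcomp Require Import all_boot.
Set Implicit Arguments. Unset Strict Implicit. Unset Printing Implicit Defensive.

(** Take a 5-cycle C of G for which the set R of the vertices v such that N[v]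
    meets C as the closed neighbourhood of some vertex of C does is as large as
    possible.  Forbidding C4 and C6 makes R a 5-ring, and 2P3 makes it a 5-crown.
    Of the remaining vertices, those complete to C are universal.  For any other
    vertex w, N(w) meets R in a clique, by the choice of C and the absence of C6
    and of the 3-pentagon; the same holds for the union of these cliques over the
    ends of an edge (C6, C7, 3-pentagon), and no induced P3 consists of such
    vertices (2P3, C6, C7).  So they induce a disjoint union of cliques, and in each
    of these cliques a vertex with fewest neighbours outside is simplicial in G
    (C4): there are no such vertices.  The 5-cycle itself exists by Dirac's theorem
    on simplicial vertices of chordal graphs.

    Conversely, map an induced subgraph of a 5-crown to Z/5 by the parts that
    contain its vertices.  Vertices of the same part are adjacent and have nested
    neighbourhoods, so the map is injective on C4, C6, C7 and the 3-pentagon; what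
    remains is a finite check. *)

Section Graph.

Variables (T : finType) (e : rel T).
Hypotheses (e_sym : symmetric e) (e_irr : irreflexive e).

Ltac adj := match goal with
  | H : is_true (e ?x ?y) |- is_true (e ?x ?y) => exact: H
  | H : is_true (e ?y ?x) |- is_true (e ?x ?y) => by rewrite e_sym; exact: H
  | H : is_true (~~ e ?x ?y) |- is_true (~~ e ?x ?y) => exact: H
  | H : is_true (~~ e ?y ?x) |- is_true (~~ e ?x ?y) => by rewrite e_sym; exact: H
  end.

Ltac clash := match goal with
  | H : is_true (e ?x ?x) |- _ => by rewrite e_irr in H
  | H : is_true (~~ (?x == ?x)) |- _ => by rewrite eqxx in H
  | H : is_true (e ?x ?y), H' : is_true (~~ e ?x ?y) |- _ => by rewrite H in H'
  | H : is_true (e ?x ?y), H' : is_true (~~ e ?y ?x) |- _ => by rewrite e_sym H in H'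
  end.

(** Without a recorded inequality, two vertices are told apart by a third one that is adjacent to
    exactly one of them, or by irreflexivity. *)
Ltac neq := match goal with
  | H : is_true (?x != ?y) |- is_true (?x != ?y) => exact: H
  | H : is_true (?y != ?x) |- is_true (?x != ?y) => by rewrite eq_sym; exact: H
  | |- is_true (?x != ?y) => apply/eqP => xy; subst; clash
  end.

Lemma induced_seq n (h : rel 'I_n) (z : T) (s : seq T) :
  uniq s -> size s = n ->
  (forall i j : 'I_n, e (nth z s i) (nth z s j) = h i j) -> has_induced e h.
Proof.
move=> us sz eh; exists (fun i : 'I_n => nth z s i); split=> // i j /eqP.
by rewrite nth_uniq ?sz // => /eqP /val_inj.
Qed.

(** * Forbidden induced subgraphs in terms of their vertices *)

Definition twoP3_free := forall a b c a' b' c',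
  e a b -> e b c -> ~~ e a c -> a != c ->
  e a' b' -> e b' c' -> ~~ e a' c' -> a' != c' ->
  ~~ e a a' -> ~~ e a b' -> ~~ e a c' ->
  ~~ e b a' -> ~~ e b b' -> ~~ e b c' ->
  ~~ e c a' -> ~~ e c b' -> ~~ e c c' -> False.

(** Opposite vertices of a 4-cycle have the same neighbours, so adjacency cannot tell them apart and
    two inequalities are assumed; likewise for the ends of each path in [twoP3_free]. In the longer
    cycles and the 3-pentagon adjacency separates all vertices. *)
Definition C4_free := forall a b c d,
  e a b -> e b c -> e c d -> e d a ->
  ~~ e a c -> ~~ e b d -> a != c -> b != d -> False.

Definition C6_free := forall a b c d f g,
  e a b -> e b c -> e c d -> e d f -> e f g -> e g a ->
  ~~ e a c -> ~~ e a d -> ~~ e a f -> ~~ e b d -> ~~ e b f -> ~~ e b g ->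
  ~~ e c f -> ~~ e c g -> ~~ e d g -> False.

Definition C7_free := forall a b c d f g h,
  e a b -> e b c -> e c d -> e d f -> e f g -> e g h -> e h a ->
  ~~ e a c -> ~~ e a d -> ~~ e a f -> ~~ e a g ->
  ~~ e b d -> ~~ e b f -> ~~ e b g -> ~~ e b h ->
  ~~ e c f -> ~~ e c g -> ~~ e c h ->
  ~~ e d g -> ~~ e d h -> ~~ e f h -> False.

Definition pent3_free := forall a b1 b2 b3 c1 c2 c3,
  e a b1 -> e a b2 -> e a b3 -> e b1 c1 -> e b2 c2 -> e b3 c3 ->
  e c1 c2 -> e c1 c3 -> e c2 c3 ->
  ~~ e a c1 -> ~~ e a c2 -> ~~ e a c3 ->
  ~~ e b1 b2 -> ~~ e b1 b3 -> ~~ e b2 b3 ->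
  ~~ e b1 c2 -> ~~ e b1 c3 -> ~~ e b2 c1 -> ~~ e b2 c3 ->
  ~~ e b3 c1 -> ~~ e b3 c2 -> False.

Ltac entries :=
  repeat match goal with H : is_true (~~ e _ _) |- _ => move/negbTE: H => H end;
  intros [[|[|[|[|[|[|[|?]]]]]]] ?] [[|[|[|[|[|[|[|?]]]]]]] ?] => //;
  rewrite /twoP3_rel /cycle_rel /pent3_rel /pent3_half /= ?e_irr //;
  first [by [] | by rewrite e_sym].

Ltac seq_uniq := rewrite /= !inE !negb_or; repeat (apply/andP; split); rewrite //; neq.

Lemma twoP3_freeP : ~ has_induced e twoP3_rel -> twoP3_free.
Proof.
move=> F a b c a' b' c' *; apply: F.
apply: (@induced_seq _ _ a [:: a; b; c; a'; b'; c']) => //; [seq_uniq | entries].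
Qed.

Lemma C4_freeP : ~ has_induced e (@cycle_rel 4) -> C4_free.
Proof.
move=> F a b c d *; apply: F.
apply: (@induced_seq _ _ a [:: a; b; c; d]) => //; [seq_uniq | entries].
Qed.

Lemma C6_freeP : ~ has_induced e (@cycle_rel 6) -> C6_free.
Proof.
move=> F a b c d f g *; apply: F.
apply: (@induced_seq _ _ a [:: a; b; c; d; f; g]) => //; [seq_uniq | entries].
Qed.

Lemma C7_freeP : ~ has_induced e (@cycle_rel 7) -> C7_free.
Proof.
move=> F a b c d f g h *; apply: F.
apply: (@induced_seq _ _ a [:: a; b; c; d; f; g; h]) => //; [seq_uniq | entries].
Qed.

Lemma pent3_freeP : ~ has_induced e pent3_rel -> pent3_free.
Proof.
move=> F a b1 b2 b3 c1 c2 c3 *; apply: F.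
apply: (@induced_seq _ _ a [:: a; b1; b2; b3; c1; c2; c3]) => //; [seq_uniq | entries].
Qed.

(** * 5-cycles and rings *)

Section Ring.

Hypotheses (twoP3F : twoP3_free) (C4F : C4_free) (C6F : C6_free)
           (C7F : C7_free) (pent3F : pent3_free).

Ltac hole4 a b c d := exfalso; apply: (C4F (a := a) (b := b) (c := c) (d := d));
  first [adj | neq].
Ltac hole6 a b c d f g := exfalso;
  apply: (C6F (a := a) (b := b) (c := c) (d := d) (f := f) (g := g)); adj.
Ltac hole7 a b c d f g h := exfalso;
  apply: (C7F (a := a) (b := b) (c := c) (d := d) (f := f) (g := g) (h := h)); adj.
Ltac pent a b1 b2 b3 c1 c2 c3 := exfalso;
  apply: (pent3F (a := a) (b1 := b1) (b2 := b2) (b3 := b3)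
                 (c1 := c1) (c2 := c2) (c3 := c3)); adj.
Ltac two_paths a b c a' b' c' := exfalso;
  apply: (twoP3F (a := a) (b := b) (c := c) (a' := a') (b' := b') (c' := c'));
  first [adj | neq].

Definition C5 x0 x1 x2 x3 x4 :=
  [&& e x0 x1, e x1 x2, e x2 x3, e x3 x4 & e x4 x0] &&
  [&& ~~ e x0 x2, ~~ e x1 x3, ~~ e x2 x4, ~~ e x3 x0 & ~~ e x4 x1].

(* The vertices that see a 5-cycle p q r s t exactly in N[q]. *)
Definition twins p q r s t :=
  [set v | [&& e v p, (v == q) || e v q, e v r, ~~ e v s & ~~ e v t]].

Definition ring x0 x1 x2 x3 x4 :=
  twins x4 x0 x1 x2 x3 :|: twins x0 x1 x2 x3 x4 :|: twins x1 x2 x3 x4 x0 :|: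
  twins x2 x3 x4 x0 x1 :|: twins x3 x4 x0 x1 x2.

Definition maxC5 x0 x1 x2 x3 x4 := C5 x0 x1 x2 x3 x4 /\
  forall y0 y1 y2 y3 y4, C5 y0 y1 y2 y3 y4 ->
    #|ring y0 y1 y2 y3 y4| <= #|ring x0 x1 x2 x3 x4|.

Ltac open_C5 H := case/andP: (H) => /and5P[? ? ? ? ?] /and5P[? ? ? ? ?].
Ltac open_twins H := move: (H); rewrite [_ \in twins _ _ _ _ _]inE => /and5P[? ? ? ? ?].

(** Rotation and reversal generate all symmetries of the cycle, so that later arguments can be
    written for a single position. *)
Lemma C5_rot x0 x1 x2 x3 x4 : C5 x0 x1 x2 x3 x4 -> C5 x1 x2 x3 x4 x0.
Proof. by move=> H; open_C5 H; apply/andP; split; apply/and5P; split; adj. Qed.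

Lemma C5_rev x0 x1 x2 x3 x4 : C5 x0 x1 x2 x3 x4 -> C5 x0 x4 x3 x2 x1.
Proof. by move=> H; open_C5 H; apply/andP; split; apply/and5P; split; adj. Qed.

Lemma twins_rev p q r s t : twins p q r s t = twins r q p t s.
Proof.
apply/setP=> v; rewrite !inE.
by case: (e v p); case: (e v r); case: (e v s); case: (e v t); rewrite ?andbF.
Qed.

Lemma ring_rot x0 x1 x2 x3 x4 : ring x1 x2 x3 x4 x0 = ring x0 x1 x2 x3 x4.
Proof.
apply/setP=> v; rewrite /ring !in_setU.
by do 5!case: (v \in twins _ _ _ _ _).
Qed.

Lemma ring_rev x0 x1 x2 x3 x4 : ring x0 x4 x3 x2 x1 = ring x0 x1 x2 x3 x4.
Proof.
apply/setP=> v; rewrite /ring !in_setU (twins_rev x1 x0) (twins_rev x0 x4) (twins_rev x4 x3).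
rewrite (twins_rev x3 x2) (twins_rev x2 x1).
by do 5!case: (v \in twins _ _ _ _ _).
Qed.

Lemma maxC5_rot x0 x1 x2 x3 x4 : maxC5 x0 x1 x2 x3 x4 -> maxC5 x1 x2 x3 x4 x0.
Proof. by case=> /C5_rot ? M; split=> // *; rewrite (ring_rot x0) M. Qed.

Lemma maxC5_rev x0 x1 x2 x3 x4 : maxC5 x0 x1 x2 x3 x4 -> maxC5 x0 x4 x3 x2 x1.
Proof. by case=> /C5_rev ? M; split=> // *; rewrite (ring_rev x0) M. Qed.

Lemma twins_adj p q r s t v : v \in twins p q r s t -> v != q -> e v q.
Proof. by rewrite inE => /and5P[_ /orP[->|]]. Qed.

Lemma C5_twins x0 x1 x2 x3 x4 : C5 x0 x1 x2 x3 x4 -> x0 \in twins x4 x0 x1 x2 x3.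
Proof. by move=> H; open_C5 H; rewrite inE eqxx; apply/and5P; split; first [by [] | adj]. Qed.

(** Otherwise [u x1 v x4] is an induced 4-cycle. *)
Lemma twins_clique x0 x1 x2 x3 x4 u v : C5 x0 x1 x2 x3 x4 ->
  u \in twins x4 x0 x1 x2 x3 -> v \in twins x4 x0 x1 x2 x3 -> u != v -> e u v.
Proof.
move=> C Hu Hv uv; open_C5 C; open_twins Hu; open_twins Hv.
by case: (boolP (e u v)) => // ?; hole4 u x1 v x4.
Qed.

(** An edge between [u] and [v] would close the induced 4-cycle [u v x3 x4]. *)
Lemma twins_far x0 x1 x2 x3 x4 u v : C5 x0 x1 x2 x3 x4 ->
  u \in twins x4 x0 x1 x2 x3 -> v \in twins x1 x2 x3 x4 x0 -> ~~ e u v.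
Proof.
move=> C Hu Hv; open_C5 C; open_twins Hu; open_twins Hv.
by case: (boolP (e u v)) => // ?; hole4 u v x3 x4.
Qed.

(** No vertex of the ring is lost when [a] takes the place of [x2]: the hypotheses preserve the
    twins of [x1] and [x3], [twins_far] those of [x0] and [x4], and [twins_clique] those of [x2].
    Maximality turns this inclusion into an equality. *)
Lemma maxC5_replace x0 x1 x2 x3 x4 a : maxC5 x0 x1 x2 x3 x4 ->
  a \in twins x1 x2 x3 x4 x0 ->
  {in twins x0 x1 x2 x3 x4, forall c, e a c} ->
  {in twins x2 x3 x4 x0 x1, forall c, e a c} ->
  maxC5 x0 x1 a x3 x4 /\ ring x0 x1 a x3 x4 = ring x0 x1 x2 x3 x4.
Proof.
move=> [C M] Ha a1 a3; open_C5 C; open_twins Ha.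
have C' : C5 x0 x1 a x3 x4.
  by apply/andP; split; apply/and5P; split; adj.
have sub : ring x0 x1 x2 x3 x4 \subset ring x0 x1 a x3 x4.
  have far0 c : c \in twins x4 x0 x1 x2 x3 -> ~~ e c a.
    by move=> Hc; exact: (twins_far C).
  have far4 c : c \in twins x3 x4 x0 x1 x2 -> ~~ e c a.
    move=> Hc; rewrite e_sym; apply: (twins_far (C5_rot (C5_rot C))) => //.
  have cl2 c : c \in twins x1 x2 x3 x4 x0 -> (c == a) || e c a.
    move=> Hc; case: eqP => //= /eqP ca; exact: (twins_clique (C5_rot (C5_rot C))).
  apply/subsetP=> v; rewrite /ring !in_setU -!orbA.
  case/or4P=> [H|H|H|/orP[] H]; open_twins H.
  - by move: (far0 _ H) => ?; apply/or4P/Or41; rewrite inE; apply/and5P.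
  - by move: (a1 _ H); rewrite e_sym => ?; apply/or4P/Or42; rewrite inE; apply/and5P.
  - by move: (cl2 _ H) => ?; apply/or4P/Or43; rewrite inE; apply/and5P.
  - move: (a3 _ H); rewrite e_sym => ?; apply/or4P/Or44/orP; left.
    by rewrite inE; apply/and5P.
  - move: (far4 _ H) => ?; apply/or4P/Or44/orP; right.
    by rewrite inE; apply/and5P.
have E : ring x0 x1 a x3 x4 = ring x0 x1 x2 x3 x4.
  by apply/esym/eqP; rewrite eqEcard sub M.
by split=> //; split=> // *; rewrite E M.
Qed.

(** If [b] saw [a], then excluding the 3-pentagon, C4 and C6 would make [a] complete to the twins of
    [x1] and [x3]. With [a] in place of [x2], the vertex [b] becomes a twin of [x1], although it
    lies outside the unchanged ring. *)
Lemma ear2_far x0 x1 x2 x3 x4 b a : maxC5 x0 x1 x2 x3 x4 ->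
  e b x0 -> e b x1 -> ~~ e b x2 -> ~~ e b x3 -> ~~ e b x4 ->
  a \in twins x1 x2 x3 x4 x0 -> ~~ e b a.
Proof.
move=> M b0 b1 b2 b3 b4 Ha; case: (boolP (e b a)) => // ba.
have [C _] := M; open_C5 C; open_twins Ha.
have ax : e a x2 by apply: (twins_adj Ha); neq.
have a1 : {in twins x0 x1 x2 x3 x4, forall c, e a c}.
  move=> c Hc; case: (boolP (e a c)) => // ac; open_twins Hc.
  have ? : ~~ e b c by case: (boolP (e b c)) => // ?; hole4 b a x2 c.
  by pent x0 b c x4 a x2 x3.
have a3 : {in twins x2 x3 x4 x0 x1, forall c, e a c}.
  move=> c Hc; case: (boolP (e a c)) => // ac; open_twins Hc.
  have ? : ~~ e b c by case: (boolP (e b c)) => // ?; hole4 b c x2 x1.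
  by hole6 b a x2 c x4 x0.
have [_ E] := maxC5_replace M Ha a1 a3.
have : b \notin ring x0 x1 x2 x3 x4.
  by rewrite !inE (negbTE b2) (negbTE b3) (negbTE b4) ?andbF.
rewrite -E /ring !in_setU.
have -> : b \in twins x0 x1 a x3 x4; last by rewrite !orbT.
by rewrite inE b1 orbT; apply/and5P.
Qed.

(** If [v] saw both [q] and [r], then [q] could replace [x1]. On the new cycle [v] sees exactly [x0]
    and [q], and [r] is still a twin of [x4], against [ear2_far]. *)
Lemma ear1_near x0 x1 x2 x3 x4 v q r : maxC5 x0 x1 x2 x3 x4 ->
  e v x0 -> ~~ e v x1 -> ~~ e v x2 -> ~~ e v x3 -> ~~ e v x4 ->
  q \in twins x0 x1 x2 x3 x4 -> r \in twins x3 x4 x0 x1 x2 ->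
  e v q -> ~~ e v r.
Proof.
move=> M v0 v1 v2 v3 v4 Hq Hr vq; case: (boolP (e v r)) => // vr.
have [C _] := M; open_C5 C; open_twins Hq; open_twins Hr.
have qx : e q x1 by apply: (twins_adj Hq); neq.
have rx : e r x4 by apply: (twins_adj Hr); neq.
have rq := twins_far (C5_rot (C5_rot (C5_rot (C5_rot C)))) Hr Hq.
have q0 : {in twins x4 x0 x1 x2 x3, forall c, e q c}.
  move=> c Hc; case: (boolP (e q c)) => // qc; open_twins Hc.
  have ? : ~~ e v c by case: (boolP (e v c)) => // ?; hole4 v c x1 q.
  case: (boolP (e c r)) => ?; first by pent r v c x3 q x1 x2.
  by hole6 v q x1 c x4 r.
have q2 : {in twins x1 x2 x3 x4 x0, forall c, e q c}.
  move=> c Hc; case: (boolP (e q c)) => // qc; open_twins Hc.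
  have ? : ~~ e v c by case: (boolP (e v c)) => // ?; hole4 v c x1 x0.
  have ? := twins_far (C5_rot (C5_rot C)) Hc Hr.
  by hole6 v q x1 c x3 r.
have [M' _] := maxC5_replace (maxC5_rot (maxC5_rot (maxC5_rot (maxC5_rot M)))) Hq q0 q2.
have := ear2_far (b := v) (a := r) (maxC5_rev (maxC5_rot (maxC5_rot M'))).
rewrite vr; apply=> //; rewrite inE.
by apply/and5P; split; first [adj | rewrite rx orbT].
Qed.

(** * Attachments of the outer vertices to the ring *)

Definition outer x0 x1 x2 x3 x4 v :=
  (v \notin ring x0 x1 x2 x3 x4) &&
  ~~ [&& e v x0, e v x1, e v x2, e v x3 & e v x4].

Lemma outer_rot x0 x1 x2 x3 x4 v :
  outer x0 x1 x2 x3 x4 v -> outer x1 x2 x3 x4 x0 v.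
Proof.
rewrite /outer (ring_rot x0); case: (v \in _) => //=.
by do 5!case: (e v _).
Qed.

Lemma outer_rev x0 x1 x2 x3 x4 v :
  outer x0 x1 x2 x3 x4 v -> outer x0 x4 x3 x2 x1 v.
Proof.
rewrite /outer (ring_rev x0); case: (v \in _) => //=.
by do 5!case: (e v _).
Qed.

Lemma outer_neq x0 x1 x2 x3 x4 v : C5 x0 x1 x2 x3 x4 ->
  outer x0 x1 x2 x3 x4 v -> v != x0.
Proof.
move=> C /andP[vR _]; apply: contraNneq vR => ->.
by rewrite /ring !in_setU (C5_twins C).
Qed.

(** If [v] saw both, C4 would force it to see [x1] as well. Then seeing both of [x3] and [x4] makes
    [v] complete to the cycle, seeing one of them gives an induced C4, and seeing neither makes [v]
    a twin of [x1]. *)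
Lemma outer_C5_far x0 x1 x2 x3 x4 v : C5 x0 x1 x2 x3 x4 ->
  outer x0 x1 x2 x3 x4 v -> e v x0 -> ~~ e v x2.
Proof.
move=> C O v0; case: (boolP (e v x2)) => // v2; open_C5 C.
have vx1 := outer_neq (C5_rot C) (outer_rot O).
have vx3 := outer_neq (C5_rot (C5_rot (C5_rot C))) (outer_rot (outer_rot (outer_rot O))).
have vx4 := outer_neq (C5_rot (C5_rot (C5_rot (C5_rot C))))
  (outer_rot (outer_rot (outer_rot (outer_rot O)))).
have v1 : e v x1 by case: (boolP (e v x1)) => // ?; hole4 v x0 x1 x2.
case: (boolP (e v x3)) => v3; case: (boolP (e v x4)) => v4.
- by case/andP: O => _; rewrite v0 v1 v2 v3 v4.
- by hole4 v x3 x4 x0.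
- by hole4 v x2 x3 x4.
case/andP: O; rewrite /ring !in_setU.
have -> : v \in twins x0 x1 x2 x3 x4; last by rewrite !orbT.
by rewrite inE v1 orbT; apply/and5P.
Qed.

(** If [p] and [q] are not adjacent, C4 makes [v] see [x0] and [x1], hence miss the rest of the
    cycle, and [v p x4 x3 x2 q] is an induced C6. *)
Lemma outer_near x0 x1 x2 x3 x4 v p q : maxC5 x0 x1 x2 x3 x4 ->
  outer x0 x1 x2 x3 x4 v ->
  p \in twins x4 x0 x1 x2 x3 -> q \in twins x0 x1 x2 x3 x4 ->
  e v p -> e v q -> e p q.
Proof.
move=> M O Hp Hq vp vq; case: (boolP (e p q)) => // pq.
have [C _] := M; open_C5 C; open_twins Hp; open_twins Hq.
have px : e p x0 by apply: (twins_adj Hp); neq.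
have qx : e q x1 by apply: (twins_adj Hq); neq.
have pnq : p != q by neq.
have vx0 := outer_neq C O.
have vx1 := outer_neq (C5_rot C) (outer_rot O).
have v0 : e v x0 by case: (boolP (e v x0)) => // ?; hole4 v p x0 q.
have v1 : e v x1 by case: (boolP (e v x1)) => // ?; hole4 v p x1 q.
have v2 := outer_C5_far C O v0.
have v3 := outer_C5_far (C5_rot C) (outer_rot O) v1.
have v4 := outer_C5_far (C5_rev (C5_rot C)) (outer_rev (outer_rot O)) v1.
by hole6 v p x4 x3 x2 q.
Qed.

(** C4 makes [v] see [x1], so [v] misses [x3] and [x4]. Its remaining traces on the cycle are
    [x0 x1], [x1 x2] and [x1] alone, which the two ear lemmas exclude. *)
Lemma outer_far x0 x1 x2 x3 x4 v p q : maxC5 x0 x1 x2 x3 x4 ->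
  outer x0 x1 x2 x3 x4 v ->
  p \in twins x4 x0 x1 x2 x3 -> q \in twins x1 x2 x3 x4 x0 ->
  e v p -> e v q -> False.
Proof.
move=> M O Hp Hq vp vq.
have [C _] := M; have pq := twins_far C Hp Hq.
open_C5 C; open_twins Hp; open_twins Hq.
have vx1 := outer_neq (C5_rot C) (outer_rot O).
have v1 : e v x1 by case: (boolP (e v x1)) => // ?; hole4 v p x1 q.
have v3 := outer_C5_far (C5_rot C) (outer_rot O) v1.
have v4 := outer_C5_far (C5_rev (C5_rot C)) (outer_rev (outer_rot O)) v1.
case: (boolP (e v x0)) => v0.
  have v2 := outer_C5_far C O v0.
  by have := ear2_far M v0 v1 v2 v3 v4 Hq; rewrite vq.
case: (boolP (e v x2)) => v2.
  rewrite twins_rev in Hp.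
  by have := ear2_far (maxC5_rev (maxC5_rot (maxC5_rot M))) v2 v1 v0 v4 v3 Hp; rewrite vp.
by have := ear1_near (maxC5_rot M) v1 v2 v3 v4 v0 Hq Hp vq; rewrite vp.
Qed.

Lemma outer_clique0 x0 x1 x2 x3 x4 v p q : maxC5 x0 x1 x2 x3 x4 ->
  outer x0 x1 x2 x3 x4 v ->
  p \in twins x4 x0 x1 x2 x3 -> q \in ring x0 x1 x2 x3 x4 ->
  e v p -> e v q -> p != q -> e p q.
Proof.
move=> M O Hp; rewrite /ring !in_setU -!orbA => Hq vp vq pq; have [C _] := M.
case/or4P: Hq => [Hq|Hq|Hq|/orP[]Hq].
- exact: (twins_clique C).
- exact: (outer_near M O).
- by case: (outer_far M O Hp Hq).
- by case: (outer_far (maxC5_rot (maxC5_rot (maxC5_rot M)))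
      (outer_rot (outer_rot (outer_rot O))) Hq Hp).
- rewrite e_sym; exact: (outer_near (maxC5_rot (maxC5_rot (maxC5_rot (maxC5_rot M))))
    (outer_rot (outer_rot (outer_rot (outer_rot O))))).
Qed.

(** Up to rotation [p] is a twin of the first vertex. The predicate takes the cycle as argument so
    that the hypotheses about it rotate along. *)
Lemma ring_wlog (P : T -> T -> T -> T -> T -> Prop) x0 x1 x2 x3 x4 p :
  (forall y0 y1 y2 y3 y4, P y1 y2 y3 y4 y0 -> P y0 y1 y2 y3 y4) ->
  (forall y0 y1 y2 y3 y4, maxC5 y0 y1 y2 y3 y4 -> p \in twins y4 y0 y1 y2 y3 ->
     P y0 y1 y2 y3 y4) ->
  maxC5 x0 x1 x2 x3 x4 -> p \in ring x0 x1 x2 x3 x4 -> P x0 x1 x2 x3 x4.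
Proof.
move=> rotP coreP M0; have M1 := maxC5_rot M0; have M2 := maxC5_rot M1.
have M3 := maxC5_rot M2; have M4 := maxC5_rot M3.
rewrite /ring !in_setU -!orbA => /or4P[|||/orP[]] Hp.
- exact: coreP.
- by apply: (rotP); exact: coreP.
- by do 2!apply: (rotP); exact: coreP.
- by do 3!apply: (rotP); exact: coreP.
- by do 4!apply: (rotP); exact: coreP.
Qed.

Lemma C5_ring x0 x1 x2 x3 x4 : C5 x0 x1 x2 x3 x4 -> x0 \in ring x0 x1 x2 x3 x4.
Proof. by move=> C; rewrite /ring !in_setU (C5_twins C). Qed.

Lemma twins_ring x0 x1 x2 x3 x4 p :
  p \in twins x4 x0 x1 x2 x3 -> p \in ring x0 x1 x2 x3 x4.
Proof. by rewrite /ring !in_setU => ->. Qed.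

Lemma C5_mem x0 x1 x2 x3 x4 (R := ring x0 x1 x2 x3 x4) : C5 x0 x1 x2 x3 x4 ->
  [/\ x0 \in R, x1 \in R, x2 \in R, x3 \in R & x4 \in R].
Proof.
move=> C0; have C1 := C5_rot C0; have C2 := C5_rot C1; have C3 := C5_rot C2.
have C4 := C5_rot C3; rewrite /R; split; first exact: C5_ring.
- by rewrite -(ring_rot x0) C5_ring.
- by rewrite -(ring_rot x0) -(ring_rot x1) C5_ring.
- by rewrite -(ring_rot x0) -(ring_rot x1) -(ring_rot x2) C5_ring.
- by rewrite -(ring_rot x0) -(ring_rot x1) -(ring_rot x2) -(ring_rot x3) C5_ring.
Qed.

Lemma outer_clique x0 x1 x2 x3 x4 v p q : maxC5 x0 x1 x2 x3 x4 ->
  outer x0 x1 x2 x3 x4 v ->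
  p \in ring x0 x1 x2 x3 x4 -> q \in ring x0 x1 x2 x3 x4 ->
  e v p -> e v q -> p != q -> e p q.
Proof.
move=> M O Hp Hq vp vq pq.
apply: (ring_wlog (P := fun x0 x1 x2 x3 x4 => outer x0 x1 x2 x3 x4 v ->
  q \in ring x0 x1 x2 x3 x4 -> e p q) _ _ M Hp O Hq) => {x0 x1 x2 x3 x4 M O Hp Hq}.
  move=> y0 y1 y2 y3 y4 IH O Hq.
  by apply: IH; [exact: outer_rot | rewrite (ring_rot y0)].
by move=> y0 y1 y2 y3 y4 M Hp O Hq; exact: (outer_clique0 M O).
Qed.

Lemma outer_sep x0 x1 x2 x3 x4 v p q : maxC5 x0 x1 x2 x3 x4 ->
  outer x0 x1 x2 x3 x4 v ->
  p \in ring x0 x1 x2 x3 x4 -> q \in ring x0 x1 x2 x3 x4 ->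
  e v p -> ~~ e p q -> p != q -> ~~ e v q.
Proof.
move=> M O Hp Hq vp pq npq; apply: contraNN pq => vq.
exact: (outer_clique M O).
Qed.

(** The last conclusion is an exclusive or: with both edges [w x4 x3 w'] is an induced C4, with
    neither [p w w' q x3 x4] is an induced C6. The same C6 arises if both [w] and [w'] see [x1], and
    a C4 through [x1] if only one does. *)
Lemma edge_far_sides x0 x1 x2 x3 x4 w w' p q : maxC5 x0 x1 x2 x3 x4 ->
  outer x0 x1 x2 x3 x4 w -> outer x0 x1 x2 x3 x4 w' -> e w w' ->
  p \in twins x4 x0 x1 x2 x3 -> q \in twins x1 x2 x3 x4 x0 ->
  e w p -> e w' q ->
  [/\ ~~ e w x1, ~~ e w' x1 & e w x4 = ~~ e w' x3].
Proof.
move=> M O O' ww' Hp Hq wp w'q; have [C _] := M.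
have pq := twins_far C Hp Hq; open_C5 C; open_twins Hp; open_twins Hq.
have M2 := maxC5_rot (maxC5_rot M); have O2 := outer_rot (outer_rot O).
have O2' := outer_rot (outer_rot O').
have Rp := twins_ring Hp.
have Rq : q \in ring x0 x1 x2 x3 x4.
  by rewrite -(ring_rot x0) -(ring_rot x1) twins_ring.
have [R0 R1 _ R3 R4] := C5_mem C.
have sw a b : a \in ring x0 x1 x2 x3 x4 -> b \in ring x0 x1 x2 x3 x4 ->
  e w a -> ~~ e a b -> a != b -> ~~ e w b by exact: outer_sep.
have sw' a b : a \in ring x0 x1 x2 x3 x4 -> b \in ring x0 x1 x2 x3 x4 ->
  e w' a -> ~~ e a b -> a != b -> ~~ e w' b by exact: outer_sep.
have wq : ~~ e w q by apply: (sw p q) => //; neq.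
have w'p : ~~ e w' p by apply: (sw' q p) => //; first [adj | neq].
have w3 : ~~ e w x3 by apply: (sw p) => //; neq.
have w'4 : ~~ e w' x4 by apply: (sw' q) => //; neq.
case: (boolP (e w x1)) => w1; case: (boolP (e w' x1)) => w'1.
- have w4 : ~~ e w x4 by apply: (sw x1) => //; first [adj | neq].
  have w'3 : ~~ e w' x3 by apply: (sw' x1) => //; first [adj | neq].
  by hole6 p w w' q x3 x4.
- by hole4 x1 w w' q.
- by hole4 x1 w' w p.
split=> //; case: (boolP (e w x4)) => w4; case: (boolP (e w' x3)) => w'3 //.
- by hole4 w x4 x3 w'.
- by hole6 p w w' q x3 x4.
Qed.

Lemma edge_far_aux x0 x1 x2 x3 x4 w w' p q : maxC5 x0 x1 x2 x3 x4 ->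
  outer x0 x1 x2 x3 x4 w -> outer x0 x1 x2 x3 x4 w' -> e w w' ->
  p \in twins x4 x0 x1 x2 x3 -> q \in twins x1 x2 x3 x4 x0 ->
  e w p -> e w' q -> e w x4 -> False.
Proof.
move=> M O O' ww' Hp Hq wp w'q w4; have [C _] := M.
have [w1 w'1] := edge_far_sides M O O' ww' Hp Hq wp w'q.
rewrite w4 => /esym; rewrite -/(is_true _) => w'3.
pose rot4 := fun x0 x1 x2 x3 x4 (H : maxC5 x0 x1 x2 x3 x4) =>
  maxC5_rot (maxC5_rot (maxC5_rot (maxC5_rot H))).
(* The reflection fixing [x2] exchanges [x0] and [x4]. Applied to [x4] in the role of [p],
   [edge_far_sides] then shows that [w] sees [x0]. *)
have M' := maxC5_rev (rot4 _ _ _ _ _ M).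
have rO v : outer x0 x1 x2 x3 x4 v -> outer x4 x3 x2 x1 x0 v.
  by move=> ?; apply: outer_rev; do 4!apply: outer_rot.
rewrite twins_rev in Hq; have [C' _] := M'.
have [w3 _] := edge_far_sides M' (rO _ O) (rO _ O') ww' (C5_twins C') Hq w4 w'q.
rewrite w'1 -/(is_true _) => w0.
have wq : ~~ e w q.
  by apply/negP; exact: (outer_far M' (rO _ O) (C5_twins C') Hq w4).
have w'4 : ~~ e w' x4.
  by apply/negP => ?; exact: (outer_far M' (rO _ O') (C5_twins C') Hq).
rewrite twins_rev in Hq.
have w'0 : ~~ e w' x0.
  by apply/negP => ?; exact: (outer_far M O' (C5_twins C) Hq).
open_C5 C; open_twins Hp; open_twins Hq.
by pent q w' x1 x3 w x0 x4.
Qed.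

Lemma edge_far x0 x1 x2 x3 x4 w w' p q : maxC5 x0 x1 x2 x3 x4 ->
  outer x0 x1 x2 x3 x4 w -> outer x0 x1 x2 x3 x4 w' -> e w w' ->
  p \in twins x4 x0 x1 x2 x3 -> q \in twins x1 x2 x3 x4 x0 ->
  e w p -> e w' q -> False.
Proof.
move=> M O O' ww' Hp Hq wp w'q.
have [_ _ w43] := edge_far_sides M O O' ww' Hp Hq wp w'q.
case: (boolP (e w x4)) => w4; first exact: (edge_far_aux M O O' ww' Hp Hq).
have w'3 : e w' x3 by move: w43; rewrite (negbTE w4) => /esym/negbFE.
(* The other case is the mirror image under the reflection fixing [x1], with [w] and [w']
   exchanged. *)
rewrite e_sym in ww'; rewrite twins_rev in Hp; rewrite twins_rev in Hq.
apply: (edge_far_aux (maxC5_rev (maxC5_rot (maxC5_rot M)))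
  (outer_rev (outer_rot (outer_rot O'))) (outer_rev (outer_rot (outer_rot O))) ww' Hq Hp) => //.
Qed.

(** If [p] and [q] are not adjacent, [outer_near] excludes the edges [w q] and [w' p], and
    [outer_far] with [edge_far] keeps [w] and [w'] away from [x2], [x3] and [x4]. So
    [p w w' q x2 x3 x4] is an induced C7. *)
Lemma edge_near x0 x1 x2 x3 x4 w w' p q : maxC5 x0 x1 x2 x3 x4 ->
  outer x0 x1 x2 x3 x4 w -> outer x0 x1 x2 x3 x4 w' -> e w w' ->
  p \in twins x4 x0 x1 x2 x3 -> q \in twins x0 x1 x2 x3 x4 ->
  e w p -> e w' q -> e p q.
Proof.
move=> M O O' ww' Hp Hq wp w'q; case: (boolP (e p q)) => // pq.
have [C _] := M; open_C5 C; open_twins Hp; open_twins Hq.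
have px0 : e p x0 by apply: (twins_adj Hp); neq.
have qx1 : e q x1 by apply: (twins_adj Hq); neq.
have M1 := maxC5_rot M; have M2 := maxC5_rot M1; have M3 := maxC5_rot M2.
have M4 := maxC5_rot M3.
have rot4 v : outer x0 x1 x2 x3 x4 v -> outer x4 x0 x1 x2 x3 v.
  by move=> ?; do 4!apply: outer_rot.
have w4 : ~~ e w x4.
  apply/negP => w4; have [C4 _] := M4.
  exact: (edge_far M4 (rot4 _ O) (rot4 _ O') ww' (C5_twins C4) Hq).
have w'2 : ~~ e w' x2.
  apply/negP => w'2; have [C2 _] := M2.
  exact: (edge_far M O O' ww' Hp (C5_twins C2)).
have [C1 _] := M1; have [C2 _] := M2; have [C3 _] := M3; have [C4 _] := M4.
have wq : ~~ e w q by apply: contraNN pq => ?; exact: (outer_near M O).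
have w'p : ~~ e w' p by apply: contraNN pq => ?; exact: (outer_near M O').
have w2 : ~~ e w x2 by apply/negP; exact: (outer_far M O Hp (C5_twins C2) wp).
have w3 : ~~ e w x3.
  apply/negP=> w3.
  exact: (outer_far M3 (outer_rot (outer_rot (outer_rot O))) (C5_twins C3) Hp).
have w'3 : ~~ e w' x3.
  by apply/negP=> w'3; exact: (outer_far M1 (outer_rot O') Hq (C5_twins C3)).
have w'4 : ~~ e w' x4.
  by apply/negP=> w'4; exact: (outer_far M4 (rot4 _ O') (C5_twins C4) Hq).
by hole7 p w w' q x2 x3 x4.
Qed.

Lemma edge_clique x0 x1 x2 x3 x4 w w' p q : maxC5 x0 x1 x2 x3 x4 ->
  outer x0 x1 x2 x3 x4 w -> outer x0 x1 x2 x3 x4 w' -> e w w' ->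
  p \in ring x0 x1 x2 x3 x4 -> q \in ring x0 x1 x2 x3 x4 ->
  e w p -> e w' q -> p != q -> e p q.
Proof.
move=> M O O' ww' Hp Hq wp w'q pq.
apply: (ring_wlog (P := fun x0 x1 x2 x3 x4 => outer x0 x1 x2 x3 x4 w ->
  outer x0 x1 x2 x3 x4 w' -> q \in ring x0 x1 x2 x3 x4 -> e p q)
  _ _ M Hp O O' Hq) => {x0 x1 x2 x3 x4 M O O' Hp Hq}.
  move=> y0 y1 y2 y3 y4 IH O O' Hq.
  by apply: IH; [exact: outer_rot | exact: outer_rot | rewrite (ring_rot y0)].
move=> y0 y1 y2 y3 y4 M Hp O O'; have [C _] := M; have w'w := ww'.
rewrite e_sym in w'w; rewrite /ring !in_setU -!orbA => /or4P[|||/orP[]] Hq.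
- exact: (twins_clique C).
- exact: (edge_near M O O').
- by case: (edge_far M O O' ww' Hp Hq).
- by case: (edge_far (maxC5_rot (maxC5_rot (maxC5_rot M)))
      (outer_rot (outer_rot (outer_rot O'))) (outer_rot (outer_rot (outer_rot O)))
      w'w Hq Hp).
- rewrite e_sym; apply: (edge_near (maxC5_rot (maxC5_rot (maxC5_rot (maxC5_rot M)))) _ _
    w'w Hq Hp) => //; by do 4!apply: outer_rot.
Qed.

(** The middle vertex misses [x0], [x2], [x3] and [x4]. If neither [w0 x4] nor [w2 x3] is an edge,
    the path closes up through [x2 x3 x4 x0] to an induced C7; otherwise it closes up through
    [x2 x1 x0] to an induced C6, unless exactly one of them is an edge and the other end sees
    [x1]. *)
Lemma path_sides x0 x1 x2 x3 x4 w0 w1 w2 : maxC5 x0 x1 x2 x3 x4 ->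
  outer x0 x1 x2 x3 x4 w0 -> outer x0 x1 x2 x3 x4 w1 -> outer x0 x1 x2 x3 x4 w2 ->
  e w0 w1 -> e w1 w2 -> ~~ e w0 w2 -> w0 != w2 -> e w0 x0 -> e w2 x2 ->
  [&& e w0 x1, ~~ e w2 x1, e w2 x3 & ~~ e w0 x4] ||
  [&& e w2 x1, ~~ e w0 x1, e w0 x4 & ~~ e w2 x3].
Proof.
move=> M O0 O1 O2 w01 w12 w02 nw02 a0 c2; have [C _] := M; open_C5 C.
have [R0 R1 R2 R3 R4] := C5_mem C.
have sep0 p q : p \in ring x0 x1 x2 x3 x4 -> q \in ring x0 x1 x2 x3 x4 ->
  e w0 p -> ~~ e p q -> p != q -> ~~ e w0 q by exact: outer_sep.
have sep2 p q : p \in ring x0 x1 x2 x3 x4 -> q \in ring x0 x1 x2 x3 x4 ->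
  e w2 p -> ~~ e p q -> p != q -> ~~ e w2 q by exact: outer_sep.
have sep01 p q : p \in ring x0 x1 x2 x3 x4 -> q \in ring x0 x1 x2 x3 x4 ->
  e w0 p -> ~~ e p q -> p != q -> ~~ e w1 q.
  by move=> Hp Hq wp pq npq; apply: contraNN pq => wq; exact: (edge_clique M O0 O1).
have sep21 p q : p \in ring x0 x1 x2 x3 x4 -> q \in ring x0 x1 x2 x3 x4 ->
  e w2 p -> ~~ e p q -> p != q -> ~~ e w1 q.
  move=> Hp Hq wp pq npq; apply: contraNN pq => wq.
  by apply: (edge_clique M O2 O1) => //; adj.
have a2 : ~~ e w0 x2 by apply: (sep0 x0) => //; neq.
have a3 : ~~ e w0 x3 by apply: (sep0 x0) => //; first [adj | neq].
have c0 : ~~ e w2 x0 by apply: (sep2 x2) => //; first [adj | neq].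
have c4 : ~~ e w2 x4 by apply: (sep2 x2) => //; neq.
have b0 : ~~ e w1 x0 by apply: (sep21 x2) => //; first [adj | neq].
have b2 : ~~ e w1 x2 by apply: (sep01 x0) => //; neq.
have b3 : ~~ e w1 x3 by apply: (sep01 x0) => //; first [adj | neq].
have b4 : ~~ e w1 x4 by apply: (sep21 x2) => //; neq.
case: (boolP (e w0 x4)) => a4; case: (boolP (e w2 x3)) => c3.
- have a1 : ~~ e w0 x1 by apply: (sep0 x4) => //; neq.
  have c1 : ~~ e w2 x1 by apply: (sep2 x3) => //; first [adj | neq].
  have b1 : ~~ e w1 x1 by apply: (sep01 x4) => //; neq.
  by hole6 x0 w0 w1 w2 x2 x1.
- have a1 : ~~ e w0 x1 by apply: (sep0 x4) => //; neq.
  have b1 : ~~ e w1 x1 by apply: (sep01 x4) => //; neq.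
  by case: (boolP (e w2 x1)) => c1; [rewrite a1 orbT | hole6 x0 w0 w1 w2 x2 x1].
- have c1 : ~~ e w2 x1 by apply: (sep2 x3) => //; first [adj | neq].
  have b1 : ~~ e w1 x1 by apply: (sep21 x3) => //; first [adj | neq].
  by case: (boolP (e w0 x1)) => a1; [rewrite c1 | hole6 x0 w0 w1 w2 x2 x1].
- by hole7 x0 w0 w1 w2 x2 x3 x4.
Qed.

Lemma path_far x0 x1 x2 x3 x4 w0 w1 w2 : maxC5 x0 x1 x2 x3 x4 ->
  outer x0 x1 x2 x3 x4 w0 -> outer x0 x1 x2 x3 x4 w1 -> outer x0 x1 x2 x3 x4 w2 ->
  e w0 w1 -> e w1 w2 -> ~~ e w0 w2 -> w0 != w2 -> e w0 x0 -> ~~ e w2 x2.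
Proof.
move=> M O0 O1 O2 w01 w12 w02 nw02 a0; apply/negP => c2.
have [C _] := M; have C2 := C5_rot (C5_rot C); have O22 := outer_rot (outer_rot O2).
have M2 := maxC5_rot (maxC5_rot M).
have c4 := outer_C5_far C2 O22 c2.
have a3 := outer_C5_far (C5_rev C) (outer_rev O0) a0.
(* Each alternative supplies a new pair of vertices at distance two on the cycle, [x0, x3] or
   [x2, x4]. A second use of [path_sides] there demands an edge already excluded. *)
case/orP: (path_sides M O0 O1 O2 w01 w12 w02 nw02 a0 c2) => /and4P[].
  move=> a1 c1 c3 a4.
  have := path_sides (maxC5_rev M) (outer_rev O0) (outer_rev O1) (outer_rev O2)
    w01 w12 w02 nw02 a0 c3.
  by rewrite (negbTE a4) (negbTE c4).
move=> c1 a1 a4 c3.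
rewrite e_sym in w01; rewrite e_sym in w12; rewrite e_sym in w02; rewrite eq_sym in nw02.
have := path_sides M2 O22 (outer_rot (outer_rot O1)) (outer_rot (outer_rot O0))
    w12 w01 w02 nw02 c2 a4.
by rewrite (negbTE a3) (negbTE c3).
Qed.

(** No two vertices at distance two on the cycle both have a neighbour on the path. Hence three
    consecutive vertices of the cycle have none, and they form a 2P3 together with the path. *)
Lemma outer_P3_free x0 x1 x2 x3 x4 w0 w1 w2 : maxC5 x0 x1 x2 x3 x4 ->
  outer x0 x1 x2 x3 x4 w0 -> outer x0 x1 x2 x3 x4 w1 -> outer x0 x1 x2 x3 x4 w2 ->
  e w0 w1 -> e w1 w2 -> w0 != w2 -> e w0 w2.
Proof.
move=> M O0 O1 O2 w01 w12 nw02; case: (boolP (e w0 w2)) => // w02.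
pose t y := [|| e w0 y, e w1 y | e w2 y].
have sep y0 y1 y2 y3 y4 : maxC5 y0 y1 y2 y3 y4 -> outer y0 y1 y2 y3 y4 w0 ->
    outer y0 y1 y2 y3 y4 w1 -> outer y0 y1 y2 y3 y4 w2 -> t y0 -> ~~ t y2.
  move=> {M O0 O1 O2} M O0 O1 O2; have [C _] := M; open_C5 C.
  have [R0 _ R2 _ _] := C5_mem C.
  have n02 : y0 != y2 by neq.
  have sep v v' : outer y0 y1 y2 y3 y4 v -> outer y0 y1 y2 y3 y4 v' ->
      e v v' -> e v y0 -> ~~ e v' y2.
    move=> O O' vv' v0; apply/negP=> v2.
    by have := edge_clique M O O' vv' R0 R2 v0 v2 n02; apply/negP.
  have w10 : e w1 w0 by adj.
  have w21 : e w2 w1 by adj.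
  have w20 : ~~ e w2 w0 by adj.
  have nw20 : w2 != w0 by neq.
  rewrite /t !negb_or; case/or3P=> H; apply/and3P; split.
  - exact: outer_C5_far C O0 H.
  - exact: sep O0 O1 w01 H.
  - exact: path_far M O0 O1 O2 w01 w12 w02 nw02 H.
  - exact: sep O1 O0 w10 H.
  - exact: outer_C5_far C O1 H.
  - exact: sep O1 O2 w12 H.
  - exact: path_far M O2 O1 O0 w21 w10 w20 nw20 H.
  - exact: sep O2 O1 w21 H.
  - exact: outer_C5_far C O2 H.
have far y0 y1 y2 y3 y4 : C5 y0 y1 y2 y3 y4 -> ~~ t y0 -> ~~ t y1 -> ~~ t y2 -> False.
  rewrite /t !negb_or => C /and3P[? ? ?] /and3P[? ? ?] /and3P[? ? ?]; open_C5 C.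
  by two_paths w0 w1 w2 y0 y1 y2.
have [C0 _] := M; have C1 := C5_rot C0; have C2 := C5_rot C1.
have C3 := C5_rot C2; have C4 := C5_rot C3.
have := far _ _ _ _ _ C0; have := far _ _ _ _ _ C1; have := far _ _ _ _ _ C2.
have := far _ _ _ _ _ C3; have := far _ _ _ _ _ C4.
have M1 := maxC5_rot M; have M2 := maxC5_rot M1; have M3 := maxC5_rot M2.
have M4 := maxC5_rot M3.
have s0 := sep _ _ _ _ _ M O0 O1 O2.
have s1 := sep _ _ _ _ _ M1 (outer_rot O0) (outer_rot O1) (outer_rot O2).
have s2 := sep _ _ _ _ _ M2 (outer_rot (outer_rot O0)) (outer_rot (outer_rot O1))
  (outer_rot (outer_rot O2)).
have s3 := sep _ _ _ _ _ M3 (outer_rot (outer_rot (outer_rot O0)))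
  (outer_rot (outer_rot (outer_rot O1))) (outer_rot (outer_rot (outer_rot O2))).
have s4 := sep _ _ _ _ _ M4 (outer_rot (outer_rot (outer_rot (outer_rot O0))))
  (outer_rot (outer_rot (outer_rot (outer_rot O1))))
  (outer_rot (outer_rot (outer_rot (outer_rot O2)))).
(* What remains is propositional: a subset of Z/5 with no two elements at distance two misses three
   consecutive elements. *)
case: (t x0) s0 s1 s2 s3 s4; case: (t x1); case: (t x2); case: (t x3); case: (t x4) => /=;
  by do 20?[move=> /(_ isT) // | move=> /(_ isT isT isT) // | move=> _].
Qed.

(** * Vertices complete to the 5-cycle, and exclusion of the outer ones *)

Lemma nonouter_cases x0 x1 x2 x3 x4 v : C5 x0 x1 x2 x3 x4 ->
  ~~ outer x0 x1 x2 x3 x4 v -> v \notin ring x0 x1 x2 x3 x4 ->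
  {in ring x0 x1 x2 x3 x4, forall p, e v p}.
Proof.
move=> C O vR p; move: O; rewrite /outer vR /= negbK => /and5P[? ? ? ? ?].
have npv : p \in ring x0 x1 x2 x3 x4 -> v != p by move=> ?; apply: contraNneq vR => ->.
move=> Rp; have := npv Rp; move: Rp; open_C5 C.
rewrite /ring !in_setU -!orbA => /or4P[|||/orP[]] Hp ?; open_twins Hp;
  case: (boolP (e v p)) => // ?.
- by hole4 v x4 p x1.
- by hole4 v x0 p x2.
- by hole4 v x1 p x3.
- by hole4 v x2 p x4.
- by hole4 v x3 p x0.
Qed.

Lemma nonouter_clique x0 x1 x2 x3 x4 u v : C5 x0 x1 x2 x3 x4 ->
  ~~ outer x0 x1 x2 x3 x4 u -> u \notin ring x0 x1 x2 x3 x4 ->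
  ~~ outer x0 x1 x2 x3 x4 v -> u != v -> e u v.
Proof.
move=> C Ou Ru Ov uv; case: (boolP (v \in ring x0 x1 x2 x3 x4)) => Rv.
  exact: (nonouter_cases C Ou).
have := nonouter_cases C Ou Ru; have := nonouter_cases C Ov Rv => Uv Uu.
have [R0 _ R2 _ _] := C5_mem C.
have ? := Uv _ R0; have ? := Uv _ R2; have ? := Uu _ R0; have ? := Uu _ R2.
by open_C5 C; case: (boolP (e u v)) => // ?; hole4 u x0 v x2.
Qed.

Lemma outer_simplicial x0 x1 x2 x3 x4 w : maxC5 x0 x1 x2 x3 x4 ->
  outer x0 x1 x2 x3 x4 w -> exists v, simplicial e v.
Proof.
move=> M Ow; have [C _] := M; set out := outer x0 x1 x2 x3 x4 in Ow *.
have P3F w0 w1 w2 : out w0 -> out w1 -> out w2 -> e w0 w1 -> e w1 w2 ->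
  w0 != w2 -> e w0 w2 by exact: outer_P3_free.
(* As outer vertices induce no P3, [K] is the component of [w] among them, and a clique. *)
pose K := [set k | out k && ((k == w) || e w k)].
pose N k := [set m | ~~ out m & e k m].
have Kw : w \in K by rewrite inE eqxx Ow.
have Kout k : k \in K -> out k by rewrite inE => /andP[].
have K_clique k k' : k \in K -> k' \in K -> k != k' -> e k k'.
  rewrite !inE => /andP[Ok /orP[/eqP->|wk]] /andP[Ok' /orP[/eqP->|wk']] kk'.
  - by rewrite eqxx in kk'.
  - by [].
  - by rewrite e_sym.
  - by apply: (P3F k w k') => //; rewrite e_sym.
have K_closed k y : k \in K -> out y -> e k y -> y \in K.
  move=> Kk Oy ky; rewrite inE Oy /=; case: eqP => //= /eqP yw.
  have := Kk; rewrite inE => /andP[Ok /orP[/eqP<-//|wk]].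
  by apply: (P3F w k y) => //; rewrite eq_sym.
have N_clique k k' m m' : k \in K -> k' \in K -> m \in N k -> m' \in N k' ->
    m != m' -> e m m'.
  move=> Kk Kk'; rewrite !inE => /andP[Om km] /andP[Om' km'] mm'.
  case: (boolP (m \in ring x0 x1 x2 x3 x4)) => Rm; last exact: (nonouter_clique C Om).
  case: (boolP (m' \in ring x0 x1 x2 x3 x4)) => Rm'; last first.
    by rewrite e_sym; apply: (nonouter_clique C Om') => //; rewrite eq_sym.
  case: (eqVneq k k') => kk'.
    by rewrite -kk' in km'; apply: (outer_clique M (Kout _ Kk)).
  apply: (edge_clique M (Kout _ Kk) (Kout _ Kk')) => //; exact: K_clique.
case: (arg_minnP (fun k => #|N k|) Kw) => k Kk kmin; exists k.
have N_complete k' m : k' \in K -> m \in N k -> e k' m.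
  move=> Kk' Nm; case: (boolP (e k' m)) => // k'm.
  (* By minimality of [N k], a vertex [k'] that misses [m] has some [m'] in [N k'] outside [N k],
     and [k m m' k'] is an induced C4. *)
  have : ~~ (N k' \subset N k).
    apply/negP=> sub; have := kmin _ Kk'; rewrite leqNgt => /negP; apply.
    apply: proper_card; apply/properP; split=> //; exists m => //.
    by rewrite inE (negbTE k'm) andbF.
  case/subsetPn => m' Nm' Nkm'.
  have kk' : k != k' by apply: contraNneq Nkm' => ->.
  have mm' : m != m' by apply: contraNneq Nkm' => <-.
  have ? := N_clique _ _ _ _ Kk Kk' Nm Nm' mm'.
  have ? := K_clique _ _ Kk Kk' kk'.
  move: Nm Nm' Nkm'; rewrite !inE => /andP[Om km] /andP[Om' k'm'].
  have ? : k != m' by apply: contraNneq Om' => <-; exact: Kout.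
  have ? : m != k' by apply: contraNneq Om => ->; exact: Kout.
  by rewrite Om' /= => km'; hole4 k m m' k'.
move=> x y kx ky xy; case: (boolP (out x)) => Ox; case: (boolP (out y)) => Oy.
- exact: K_clique (K_closed _ _ Kk Ox kx) (K_closed _ _ Kk Oy ky) xy.
- by apply: (N_complete x); [exact: K_closed Kk Ox kx | rewrite inE Oy].
- by rewrite e_sym; apply: (N_complete y); [exact: K_closed Kk Oy ky | rewrite inE Ox].
- by apply: (N_clique k k) => //; rewrite inE ?Ox ?Oy.
Qed.

(** * The ring is a 5-crown *)

Lemma in_cnbhd (A : {set T}) u v :
  (v \in cnbhd e A u) = (v \in A) && ((v == u) || e u v).
Proof. by rewrite inE. Qed.

Lemma twins_nbr x0 x1 x2 x3 x4 u : C5 x0 x1 x2 x3 x4 ->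
  u \in twins x4 x0 x1 x2 x3 ->
  cnbhd e (ring x0 x1 x2 x3 x4) u \subset
    twins x3 x4 x0 x1 x2 :|: twins x4 x0 x1 x2 x3 :|: twins x0 x1 x2 x3 x4.
Proof.
move=> C Hu; have C1 := C5_rot C; have C2 := C5_rot C1; have C3 := C5_rot C2.
apply/subsetP=> v; rewrite inE => /andP[Rv /orP[/eqP->|uv]]; rewrite !in_setU.
  by rewrite Hu orbT.
move: Rv; rewrite /ring !in_setU -!orbA => /or4P[|||/orP[]] Hv;
  rewrite ?Hv ?orbT //.
- by have := twins_far C Hu Hv; rewrite uv.
- by have := twins_far C3 Hv Hu; rewrite e_sym uv.
Qed.

(** Take [a] and [b] witnessing that neither neighbourhood contains the other; both are twins of
    [x1] or [x4]. In the same class they are adjacent and [u a b v] is a C4; in different classes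
    they are not, and an induced C6 runs through [x2 x3]. *)
Lemma twins_nested x0 x1 x2 x3 x4 u v : C5 x0 x1 x2 x3 x4 ->
  u \in twins x4 x0 x1 x2 x3 -> v \in twins x4 x0 x1 x2 x3 ->
  (cnbhd e (ring x0 x1 x2 x3 x4) u \subset cnbhd e (ring x0 x1 x2 x3 x4) v) ||
  (cnbhd e (ring x0 x1 x2 x3 x4) v \subset cnbhd e (ring x0 x1 x2 x3 x4) u).
Proof.
move=> C Hu Hv; apply/norP => -[/subsetPn[a Na Nva] /subsetPn[b Nb Nub]].
have uv : u != v by apply: contraNneq Nva => <-.
have euv := twins_clique C Hu Hv uv.
have side w w' z : w \in twins x4 x0 x1 x2 x3 -> w' \in twins x4 x0 x1 x2 x3 ->
    e w w' -> z \in cnbhd e (ring x0 x1 x2 x3 x4) w ->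
    z \notin cnbhd e (ring x0 x1 x2 x3 x4) w' ->
    [/\ e w z, ~~ e w' z &
      (z \in twins x3 x4 x0 x1 x2) || (z \in twins x0 x1 x2 x3 x4)].
  move=> Hw Hw' ww' Nz; have := subsetP (twins_nbr C Hw) _ Nz.
  move: Nz; rewrite !in_cnbhd !in_setU => /andP[-> /= zw] zX.
  rewrite negb_or => /andP[zw' ew'z]; split=> //.
    by case/orP: zw => // /eqP zw; rewrite zw e_sym ww' in ew'z.
  case/orP: zX => [/orP[->//|zX]|->]; last by rewrite orbT.
  by rewrite eq_sym in zw'; have := twins_clique C Hw' zX zw'; rewrite (negbTE ew'z).
have evu : e v u by adj.
have [ua va] := side u v a Hu Hv euv Na Nva.
have [vb ub] := side v u b Hv Hu evu Nb Nub.
have ab : a != b by neq.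
open_C5 C; open_twins Hu; open_twins Hv.
case/orP=> Hb /orP[] Ha; open_twins Ha; open_twins Hb.
- have := twins_clique (C5_rot (C5_rot (C5_rot (C5_rot C)))) Ha Hb ab.
  by move=> ?; hole4 u a b v.
- have := twins_far (C5_rot (C5_rot (C5_rot (C5_rot C)))) Hb Ha => ?.
  by hole6 v u a x2 x3 b.
- have := twins_far (C5_rot (C5_rot (C5_rot (C5_rot C)))) Ha Hb => ?.
  by hole6 v u a x3 x2 b.
- have := twins_clique (C5_rot C) Ha Hb ab.
  by move=> ?; hole4 u a b v.
Qed.

Lemma twins_cnbhd x0 x1 x2 x3 x4 : C5 x0 x1 x2 x3 x4 ->
  cnbhd e (ring x0 x1 x2 x3 x4) x0 =
    twins x3 x4 x0 x1 x2 :|: twins x4 x0 x1 x2 x3 :|: twins x0 x1 x2 x3 x4.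
Proof.
move=> C; apply/eqP; rewrite eqEsubset (twins_nbr C (C5_twins C)) /=.
apply/subsetP=> v; rewrite in_cnbhd /ring !in_setU => /orP[/orP[]|] Hv;
  rewrite Hv ?orbT /=; open_twins Hv; apply/orP; last by right; adj.
- by right; adj.
- by case: eqP => [|/eqP vx]; [left | right; rewrite e_sym; exact: twins_adj Hv vx].
Qed.

Lemma twins_sorted x0 x1 x2 x3 x4 (R := ring x0 x1 x2 x3 x4) : C5 x0 x1 x2 x3 x4 ->
  exists (u : T) (s : seq T),
    [/\ uniq (u :: s),
        (forall x, (x \in u :: s) = (x \in twins x4 x0 x1 x2 x3)),
        sorted (fun u v => cnbhd e R v \subset cnbhd e R u) (u :: s),
        twins x4 x0 x1 x2 x3 \subset cnbhd e R (last u s) &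
        cnbhd e R u =
          twins x3 x4 x0 x1 x2 :|: twins x4 x0 x1 x2 x3 :|: twins x0 x1 x2 x3 x4].
Proof.
move=> C; pose X := twins x4 x0 x1 x2 x3.
(* Comparing sizes gives a total order to sort by; within a class it implies inclusion, by
   [twins_nested]. *)
pose larger u v := #|cnbhd e R v| <= #|cnbhd e R u|.
pose s := sort larger (enum (X :\ x0)).
have X0 : x0 \in X := C5_twins C.
have mem_s x : (x \in x0 :: s) = (x \in X).
  by rewrite inE mem_sort mem_enum in_setD1; case: eqP => [->|].
have larger_sub u v : u \in X -> v \in X -> larger u v ->
    cnbhd e R v \subset cnbhd e R u.
  move=> Xu Xv uv; case/orP: (twins_nested C Xu Xv) => // uv'.
  by rewrite (_ : cnbhd e R v = cnbhd e R u) //; apply/esym/eqP; rewrite eqEcard uv'.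
exists x0, s; split=> //.
- by rewrite /= sort_uniq enum_uniq andbT mem_sort mem_enum !inE eqxx.
- have: sorted larger (x0 :: s).
    rewrite /= path_min_sorted; last first.
      apply/allP=> v; rewrite mem_sort mem_enum in_setD1 => /andP[_ Xv].
      by apply: subset_leq_card; rewrite twins_cnbhd //; exact: twins_nbr Xv.
    by apply: sort_sorted => u v; rewrite /larger; exact: leq_total.
  apply: (@sub_in_sorted _ (mem X)); first exact: larger_sub.
  by apply/allP=> v; rewrite mem_s.
- have Xl : last x0 s \in X by rewrite -mem_s mem_last.
  apply/subsetP=> v Xv; rewrite in_cnbhd /R twins_ring //=.
  by case: eqP => //= /eqP; rewrite eq_sym => lv; exact: twins_clique C Xl Xv lv.
- exact: twins_cnbhd.
Qed.

Lemma twins_min x0 x1 x2 x3 x4 : C5 x0 x1 x2 x3 x4 ->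
  exists2 y, y \in twins x4 x0 x1 x2 x3 &
    {in twins x4 x0 x1 x2 x3, forall u,
      cnbhd e (ring x0 x1 x2 x3 x4) y \subset cnbhd e (ring x0 x1 x2 x3 x4) u}.
Proof.
move=> C; set R := ring x0 x1 x2 x3 x4.
case: (arg_minnP (fun u => #|cnbhd e R u|) (C5_twins C)) => y Xy ymin; exists y => // u Xu.
case/orP: (twins_nested C Xy Xu) => // uy.
by rewrite (_ : cnbhd e R y = cnbhd e R u) //; apply/esym/eqP; rewrite eqEcard uy ymin.
Qed.

Definition complete (A B : {set T}) := [forall x in A, forall y in B, e x y].

Lemma completeP A B : reflect (complete_to e A B) (complete A B).
Proof.
apply: (iffP forall_inP) => [H x y Ax By | H x Ax]; first exact: (forall_inP (H x Ax)).
by apply/forall_inP => y; exact: H.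
Qed.

Lemma completeC A B : complete A B = complete B A.
Proof.
by apply/completeP/completeP => H x y Hx Hy; rewrite e_sym; apply: H.
Qed.

Lemma incompleteP A B : ~~ complete A B ->
  exists a b, [/\ a \in A, b \in B & ~~ e a b].
Proof.
by move/forall_inPn => [a Aa /forall_inPn[b Bb ab]]; exists a, b.
Qed.

(** Suppose all three pairs are incomplete, and let [y1], [y2] have least neighbourhoods among the
    twins of [x1], [x2]. They inherit every non-neighbour in the ring of their classes, so they are
    not adjacent, [y1] misses some twin [a0] of [x0] and [y2] some twin [c3] of [x3]: [y1 x0 a0] and
    [y2 x3 c3] form a 2P3. *)
Lemma complete_three x0 x1 x2 x3 x4 : C5 x0 x1 x2 x3 x4 ->
  [|| complete (twins x4 x0 x1 x2 x3) (twins x0 x1 x2 x3 x4),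
      complete (twins x0 x1 x2 x3 x4) (twins x1 x2 x3 x4 x0)
    | complete (twins x1 x2 x3 x4 x0) (twins x2 x3 x4 x0 x1)].
Proof.
move=> C; apply: contraT; rewrite !negb_or.
case/and3P=> /incompleteP[a0 [a1 [Ha0 Ha1 a01]]] /incompleteP[b1 [b2 [Hb1 Hb2 b12]]].
case/incompleteP=> c2 [c3 [Hc2 Hc3 c23]].
have C1 := C5_rot C; have C2 := C5_rot C1; have C3 := C5_rot C2.
have [y1 Hy1 min1] := twins_min C1; have [y2 Hy2 min2] := twins_min C2.
have low y0 z0 z1 z2 z3 z4 u a :
    {in twins z4 z0 z1 z2 z3, forall u, cnbhd e (ring z0 z1 z2 z3 z4) y0
      \subset cnbhd e (ring z0 z1 z2 z3 z4) u} -> u \in twins z4 z0 z1 z2 z3 ->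
    a \in ring z0 z1 z2 z3 z4 -> a != u -> ~~ e u a -> ~~ e y0 a.
  move=> min Hu Ra au; apply: contraNN => ya.
  have := subsetP (min _ Hu) a; rewrite !in_cnbhd Ra ya orbT /= => /(_ isT).
  by rewrite (negbTE au).
have Ra0 : a0 \in ring x1 x2 x3 x4 x0 by rewrite (ring_rot x0) twins_ring.
have Rb2 : b2 \in ring x1 x2 x3 x4 x0 by rewrite -(ring_rot x1) twins_ring.
have Ry1 : y1 \in ring x2 x3 x4 x0 x1 by rewrite (ring_rot x1) twins_ring.
have Rc3 : c3 \in ring x2 x3 x4 x0 x1 by rewrite -(ring_rot x2) twins_ring.
open_C5 C; open_twins Ha0; open_twins Ha1; open_twins Hb1; open_twins Hb2.
open_twins Hc2; open_twins Hc3; open_twins Hy1; open_twins Hy2.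
have y1a0 : ~~ e y1 a0.
  by apply: (low _ _ _ _ _ _ a1 a0 min1 Ha1 Ra0); first [neq | adj].
have y1b2 : ~~ e y1 b2.
  by apply: (low _ _ _ _ _ _ b1 b2 min1 Hb1 Rb2); first [neq | adj].
have y2y1 : ~~ e y2 y1.
  by apply: (low _ _ _ _ _ _ b2 y1 min2 Hb2 Ry1); first [neq | adj].
have y2c3 : ~~ e y2 c3.
  by apply: (low _ _ _ _ _ _ c2 c3 min2 Hc2 Rc3); first [neq | adj].
have ? : e a0 x0 by apply: (twins_adj Ha0); neq.
have ? : e c3 x3 by apply: (twins_adj Hc3); neq.
have ? := twins_far C Ha0 Hy2; have ? := twins_far C1 Hy1 Hc3.
have ? := twins_far C3 Hc3 Ha0.
by two_paths y1 x0 a0 y2 x3 c3.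
Qed.

Lemma ring_crown x0 x1 x2 x3 x4 : C5 x0 x1 x2 x3 x4 ->
  is_5crown e (ring x0 x1 x2 x3 x4).
Proof.
move=> C; have C1 := C5_rot C; have C2 := C5_rot C1; have C3 := C5_rot C2.
have C4 := C5_rot C3; have := C; move=> C'; open_C5 C'.
pose L := [:: twins x4 x0 x1 x2 x3; twins x0 x1 x2 x3 x4; twins x1 x2 x3 x4 x0;
              twins x2 x3 x4 x0 x1; twins x3 x4 x0 x1 x2].
pose X (i : 'I_5) := nth set0 L i.
have X_sh i k : X (sh i k) = nth set0 L ((i + k) %% 5).
  by rewrite /X /sh inordK // ltn_pmod.
exists X; split; last first.
  have := complete_three C; have := complete_three C1; have := complete_three C2.
  have := complete_three C3; have := complete_three C4.
  have cr (i : 'I_5) A B A' B' :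
      nth set0 L ((i + 4) %% 5) = A -> nth set0 L ((i + 3) %% 5) = B ->
      nth set0 L ((i + 1) %% 5) = A' -> nth set0 L ((i + 2) %% 5) = B' ->
      complete B A -> complete A' B' ->
      exists istar : 'I_5, complete_to e (X (sh istar 4)) (X (sh istar 3)) /\
                           complete_to e (X (sh istar 1)) (X (sh istar 2)).
    move=> <- <- <- <-; rewrite completeC => /completeP ? /completeP ?.
    by exists i; rewrite !X_sh.
  have := cr (@Ordinal 5 0 isT) _ _ _ _ erefl erefl erefl erefl.
  have := cr (@Ordinal 5 1 isT) _ _ _ _ erefl erefl erefl erefl.
  have := cr (@Ordinal 5 2 isT) _ _ _ _ erefl erefl erefl erefl.
  have := cr (@Ordinal 5 3 isT) _ _ _ _ erefl erefl erefl erefl.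
  have := cr (@Ordinal 5 4 isT) _ _ _ _ erefl erefl erefl erefl.
  (* Among the five cyclically ordered pairs of consecutive classes, every three consecutive ones
     include a complete pair. So two complete pairs are not consecutive, and these determine
     [istar]. *)
  rewrite /=; do 5!case: (complete _ _) => //=; move=> h4 h3 h2 h1 h0;
  rewrite ?orbF => *;
  solve [exact: h0 | exact: h1 | exact: h2 | exact: h3 | exact: h4].
split.
- case=> [[|[|[|[|[|?]]]]] ?] //; apply/set0Pn; rewrite /X /=.
  + by exists x0; exact: C5_twins C.
  + by exists x1; exact: C5_twins C1.
  + by exists x2; exact: C5_twins C2.
  + by exists x3; exact: C5_twins C3.
  + by exists x4; exact: C5_twins C4.
- case=> [[|[|[|[|[|?]]]]] ?] [[|[|[|[|[|?]]]]] ?] // _; rewrite /X /= disjoint_subset;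
    apply/subsetP => v Hv; rewrite -topredE /=; apply/negP => Hv';
    open_twins Hv; open_twins Hv'; clash.
- rewrite !big_ord_recl big_ord0 setU0 /X /= /ring !setUA.
  by [].
- have nth_sh (i : 'I_5) A B D : nth set0 L ((i + 4) %% 5) = A -> X i = B ->
      nth set0 L ((i + 1) %% 5) = D -> A :|: B :|: D = X (sh i 4) :|: X i :|: X (sh i 1).
    by move=> <- -> <-; rewrite !X_sh.
  have base y0 y1 y2 y3 y4 (i : 'I_5) : C5 y0 y1 y2 y3 y4 ->
      ring y0 y1 y2 y3 y4 = ring x0 x1 x2 x3 x4 ->
      nth set0 L ((i + 4) %% 5) = twins y3 y4 y0 y1 y2 ->
      X i = twins y4 y0 y1 y2 y3 ->
      nth set0 L ((i + 1) %% 5) = twins y0 y1 y2 y3 y4 ->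
      exists (u1 : T) (s : seq T),
         [/\ uniq (u1 :: s),
             (forall x, (x \in u1 :: s) = (x \in X i)),
             sorted (fun u v => cnbhd e (ring x0 x1 x2 x3 x4) v \subset
                                cnbhd e (ring x0 x1 x2 x3 x4) u) (u1 :: s),
             X i \subset cnbhd e (ring x0 x1 x2 x3 x4) (last u1 s) &
             cnbhd e (ring x0 x1 x2 x3 x4) u1 = X (sh i 4) :|: X i :|: X (sh i 1)].
    move=> Cy <- E4 E0 E1; rewrite -(nth_sh _ _ _ _ E4 E0 E1) E0.
    exact: twins_sorted.
  case=> [[|[|[|[|[|?]]]]] ?] //.
  + exact: (base _ _ _ _ _ _ C).
  + by apply: (base _ _ _ _ _ _ C1) => //; rewrite (ring_rot x0).
  + by apply: (base _ _ _ _ _ _ C2) => //; rewrite (ring_rot x1) (ring_rot x0).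
  + apply: (base _ _ _ _ _ _ C3) => //.
    by rewrite (ring_rot x2) (ring_rot x1) (ring_rot x0).
  + apply: (base _ _ _ _ _ _ C4) => //.
    by rewrite (ring_rot x3) (ring_rot x2) (ring_rot x1) (ring_rot x0).
Qed.

(** * Dirac's theorem *)

Lemma shortest_path (r : rel T) s s' : connect r s s' ->
  exists p, [/\ path r s p, last s p = s' &
    forall q, path r s q -> last s q = s' -> size p <= size q].
Proof.
case/connectP=> p0 rp0 sp0.
pose P n := [exists t : n.-tuple T, path r s t && (last s t == s')].
have PP q : path r s q -> last s q = s' -> P (size q).
  by move=> rq sq; apply/existsP; exists (in_tuple q); rewrite /= rq sq eqxx.
have exP : exists n, P n by exists (size p0); apply: PP.
case: (ex_minnP exP) => n /existsP[t /andP[rt /eqP st]] nmin.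
by exists t; split=> // q rq sq; rewrite size_tuple nmin ?PP.
Qed.

(* Closes the goal by exhibiting an r-path q from s to s' that is too short. *)
Ltac shorter r s s' min rE q :=
  let pq := fresh in let lq := fresh in exfalso;
  assert (pq : path r s q) by (rewrite /= ?rE; repeat (apply/andP; split);
    first [assumption | exact isT]);
  assert (lq : last s q = s') by (first [reflexivity | assumption]);
  generalize (min q pq lq); rewrite /= ?ltnS;
  first [by [] | by elim: (size _)].

(* Two nonadjacent neighbours s, s' of a joined through non-neighbours of a:
   a shortest such path closes up with a to an induced cycle, which is short
   because the graph is 2P3-free. *)
Lemma link_C5 a s s' (D : {set T}) : e a s -> e a s' -> ~~ e s s' -> s != s' ->
  {in D, forall z, (z != a) && ~~ e a z} ->
  connect [rel x y | [&& e x y, x \in s |: (s' |: D) & y \in s |: (s' |: D)]] s s' ->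
  exists x0 x1 x2 x3 x4, C5 x0 x1 x2 x3 x4.
Proof.
move=> as_ as' ss' ns Da; set r := (X in connect X); set Ks := s |: (s' |: D).
case/shortest_path => p [rp lp min].
have Ks_s : s \in Ks by rewrite !inE eqxx.
have Ks_s' : s' \in Ks by rewrite !inE eqxx orbT.
have inD z : z \in Ks -> z != s -> z != s' -> z != a /\ ~~ e a z.
  by rewrite !inE => /or3P[/eqP->|/eqP->|/Da /andP[] //]; rewrite eqxx.
have rE x y : r x y = [&& e x y, x \in Ks & y \in Ks] by [].
(* With 1, 3 or 4 inner vertices the path closes up with [a] to an induced C4, C6 or C7, and with 2
   to the required C5. With at least 5, [s a s'] and [k2 k3 k4] form a 2P3. *)
case: p rp lp min => [|k1 [|k2 [|k3 [|k4 [|k5 [|k6 p]]]]]] /=; rewrite ?rE.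
- by move=> _ E; rewrite E eqxx in ns.
- by case/andP=> /and3P[? _ _] _ E; rewrite -E in ss'; clash.
- case/and3P=> /and3P[sk1 _ Kk1] /and3P[k1s' _ _] _ E _; rewrite {k2}E in k1s'.
  have [||? ?] := inD k1 Kk1; try neq.
  by hole4 a s k1 s'.
- case/and4P=> /and3P[sk1 _ Kk1] /and3P[k12 _ Kk2] /and3P[k2s' _ _] _ E min.
  rewrite {k3}E in k2s'.
  have n2 : k2 != s by apply: contraNneq ss' => <-.
  have n1 : k1 != s' by apply: contraNneq ss' => <-.
  have [||? ?] := inD k1 Kk1; try neq.
  have [||? ?] := inD k2 Kk2; try neq.
  have ? : ~~ e s k2 by apply/negP=> ?; shorter r s s' min rE [:: k2; s'].
  have ? : ~~ e k1 s' by apply/negP=> ?; shorter r s s' min rE [:: k1; s'].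
  by exists a, s, k1, k2, s'; apply/andP; split; apply/and5P; split; adj.
- case/and5P=> /and3P[sk1 _ Kk1] /and3P[k12 _ Kk2] /and3P[k23 _ Kk3] /and3P[k3s' _ _] _ E min.
  rewrite {k4}E in k3s'.
  have ? : k1 != s' by apply: contraNneq ss' => <-.
  have ? : k3 != s by apply: contraNneq ss' => <-.
  have ? : k2 != s' by apply/eqP=> E; shorter r s s' min rE [:: k1; k2].
  have ? : ~~ e s k2 by apply/negP=> ?; shorter r s s' min rE [:: k2; k3; s'].
  have ? : ~~ e s k3 by apply/negP=> ?; shorter r s s' min rE [:: k3; s'].
  have ? : ~~ e k1 k3 by apply/negP=> ?; shorter r s s' min rE [:: k1; k3; s'].
  have ? : ~~ e k1 s' by apply/negP=> ?; shorter r s s' min rE [:: k1; s'].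
  have ? : ~~ e k2 s' by apply/negP=> ?; shorter r s s' min rE [:: k1; k2; s'].
  have [||? ?] := inD k1 Kk1; try neq.
  have [||? ?] := inD k2 Kk2; try neq.
  have [||? ?] := inD k3 Kk3; try neq.
  by hole6 a s k1 k2 k3 s'.
- case/and5P=> /and3P[sk1 _ Kk1] /and3P[k12 _ Kk2] /and3P[k23 _ Kk3] /and3P[k34 _ Kk4].
  case/andP=> /and3P[k4s' _ _] _ E min; rewrite {k5}E in k4s'.
  have ? : ~~ e s k2 by apply/negP=> ?; shorter r s s' min rE [:: k2; k3; k4; s'].
  have ? : ~~ e s k3 by apply/negP=> ?; shorter r s s' min rE [:: k3; k4; s'].
  have ? : ~~ e s k4 by apply/negP=> ?; shorter r s s' min rE [:: k4; s'].
  have ? : ~~ e k1 k3 by apply/negP=> ?; shorter r s s' min rE [:: k1; k3; k4; s'].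
  have ? : ~~ e k1 k4 by apply/negP=> ?; shorter r s s' min rE [:: k1; k4; s'].
  have ? : ~~ e k1 s' by apply/negP=> ?; shorter r s s' min rE [:: k1; s'].
  have ? : ~~ e k2 k4 by apply/negP=> ?; shorter r s s' min rE [:: k1; k2; k4; s'].
  have ? : ~~ e k2 s' by apply/negP=> ?; shorter r s s' min rE [:: k1; k2; s'].
  have ? : ~~ e k3 s' by apply/negP=> ?; shorter r s s' min rE [:: k1; k2; k3; s'].
  have [||? ?] := inD k1 Kk1; try neq.
  have [||? ?] := inD k2 Kk2; try neq.
  have [||? ?] := inD k3 Kk3; try neq.
  have [||? ?] := inD k4 Kk4; try neq.
  by hole7 a s k1 k2 k3 k4 s'.
- case/and5P=> /and3P[sk1 _ Kk1] /and3P[k12 _ Kk2] /and3P[k23 _ Kk3] /and3P[k34 _ Kk4].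
  case/and3P=> /and3P[k45 _ Kk5] /and3P[k56 _ Kk6] pp E min.
  have ? : k2 != s' by apply/eqP=> E'; shorter r s s' min rE [:: k1; k2].
  have ? : k3 != s' by apply/eqP=> E'; shorter r s s' min rE [:: k1; k2; k3].
  have ? : k4 != s' by apply/eqP=> E'; shorter r s s' min rE [:: k1; k2; k3; k4].
  have ? : ~~ e k2 s' by apply/negP=> ?; shorter r s s' min rE [:: k1; k2; s'].
  have ? : ~~ e k3 s' by apply/negP=> ?; shorter r s s' min rE [:: k1; k2; k3; s'].
  have ? : ~~ e k4 s' by apply/negP=> ?; shorter r s s' min rE [:: k1; k2; k3; k4; s'].
  have ? : ~~ e s k2 by apply/negP=> ?; shorter r s s' min rE [:: k2, k3, k4, k5, k6 & p].
  have ? : ~~ e s k3 by apply/negP=> ?; shorter r s s' min rE [:: k3, k4, k5, k6 & p].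
  have ? : ~~ e s k4 by apply/negP=> ?; shorter r s s' min rE [:: k4, k5, k6 & p].
  have ? : ~~ e s k5 by apply/negP=> ?; shorter r s s' min rE [:: k5, k6 & p].
  have ? : ~~ e k2 k4 by apply/negP=> ?; shorter r s s' min rE [:: k1, k2, k4, k5, k6 & p].
  have ? : ~~ e k2 k5 by apply/negP=> ?; shorter r s s' min rE [:: k1, k2, k5, k6 & p].
  have [||? ?] := inD k2 Kk2; try neq.
  have [||? ?] := inD k3 Kk3; try neq.
  have [||? ?] := inD k4 Kk4; try neq.
  by two_paths s a s' k2 k3 k4.
Qed.

Definition simplicial_in (A : {set T}) v :=
  {in A &, forall x y, e v x -> e v y -> x != y -> e x y}.

(* Dirac's theorem, in the form that survives induction: the vertex is found
   among the non-neighbours of a prescribed vertex a. *)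
Lemma chordal_simplicial (noC5 : ~ exists x0 x1 x2 x3 x4, C5 x0 x1 x2 x3 x4)
    (A : {set T}) a b : a \in A -> b \in A -> b != a -> ~~ e a b ->
  exists v, [/\ v \in A, v != a, ~~ e a v & simplicial_in A v].
Proof.
have [n] := ubnP #|A|; elim: n => // n IH in A a b *; rewrite ltnS => An Aa Ab ba ab.
pose D := [set z in A | (z != a) && ~~ e a z].
pose r := [rel x y | [&& e x y, x \in D & y \in D]].
have DA z : z \in D -> [/\ z \in A, z != a & ~~ e a z].
  by rewrite inE => /and3P[].
have Db : b \in D by rewrite inE Ab ba.
pose K := [set z in D | connect r b z].
have KD z : z \in K -> z \in D by rewrite inE => /andP[].
have Kb : b \in K by rewrite inE Db connect0.
have K_closed k z : k \in K -> z \in D -> e k z -> z \in K.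
  move=> Kk Dz kz; rewrite inE Dz /=; have := Kk; rewrite inE => /andP[Dk].
  by move/connect_trans; apply; apply: connect1; rewrite /= kz Dk.
(* [K] is the component of [b] among the non-neighbours of [a], and [S] separates it from [a]. As
   [S] is a clique by [link_C5], the induction can move to [K :|: S], which omits [a]. *)
pose S := [set s in A | e a s && [exists k in K, e k s]].
have SP s : s \in S -> [/\ s \in A, e a s & exists2 k, k \in K & e k s].
  by rewrite inE => /and3P[? ? /exists_inP].
have K_nbr k z : k \in K -> z \in A -> e k z -> z \in K :|: S.
  move=> Kk Az kz; rewrite in_setU; case: (boolP (z \in D)) => Dz.
    by rewrite (K_closed k).
  have az : e a z.
    move: Dz; rewrite inE Az /= negb_and !negbK => /orP[/eqP za|//].
    by have [_ _] := DA _ (KD _ Kk); rewrite -za e_sym kz.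
  by apply/orP; right; rewrite inE Az az; apply/exists_inP; exists k.
have S_clique s s' : s \in S -> s' \in S -> s != s' -> e s s'.
  move=> /SP[As as_ [k Kk ks]] /SP[As' as' [k' Kk' ks']] nss.
  case: (boolP (e s s')) => // ss'; case: noC5.
  apply: (link_C5 as_ as' ss' nss (D := D)); first by move=> z /DA[_ -> ->].
  set r' := (X in connect X).
  have r'E x y : e x y -> x \in s |: (s' |: D) -> y \in s |: (s' |: D) -> r' x y.
    by move=> xy Hx Hy; apply/and3P.
  have inD z : z \in D -> z \in s |: (s' |: D) by rewrite !in_setU => ->; rewrite !orbT.
  have sub : subrel (connect r) (connect r').
    apply: connect_sub => x y /and3P[xy Dx Dy].
    by apply: connect1; apply: r'E => //; exact: inD.
  have rC : connect_sym r.
    by apply: sym_connect_sym => x y /=; rewrite e_sym; congr (_ && _); exact: andbC.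
  have sk : connect r' s k.
    apply: connect1; apply: r'E; [by rewrite e_sym | by rewrite !inE eqxx | exact/inD/KD].
  have k's' : connect r' k' s'.
    by apply: connect1; apply: r'E => //; [exact/inD/KD | rewrite !inE eqxx orbT].
  apply: (connect_trans sk (connect_trans _ k's')); apply: sub.
  move: Kk Kk'; rewrite !inE => /andP[_ bk] /andP[_ bk'].
  by apply: connect_trans bk'; rewrite rC.
have A'n : #|K :|: S| < n.
  apply: leq_trans An; apply: proper_card; apply/properP; split.
    apply/subsetP=> z; rewrite in_setU => /orP[/KD/DA[]|/SP[]] //.
  exists a => //; rewrite in_setU; apply/norP; split.
    by apply/negP=> /KD/DA[_]; rewrite eqxx.
  by apply/negP=> /SP[_]; rewrite e_irr.
have K_simpl v : v \in K -> simplicial_in (K :|: S) v ->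
    exists v, [/\ v \in A, v != a, ~~ e a v & simplicial_in A v].
  move=> Kv sv; exists v; have [Av va av] := DA _ (KD _ Kv); split=> // x y Ax Ay vx vy.
  by apply: sv => //; exact: K_nbr Kv _ _.
(* If some [s] in [S] misses a vertex of [K], take [s] as the prescribed vertex: the vertex found
   misses [s], so it is not in the clique [S]. If [S] is complete to [K], a vertex simplicial in [K]
   suffices. *)
case: (boolP [exists s in S, exists k in K, ~~ e s k]).
  case/exists_inP=> s Ss /exists_inP[k Kk sk].
  have [_ as_ _] := SP _ Ss; have [_ _ ak] := DA _ (KD _ Kk).
  have [||||v [Kv vs sv simv]] := IH (K :|: S) s k A'n.
  - by rewrite in_setU Ss orbT.
  - by rewrite in_setU Kk.
  - by apply: contraNneq ak => ->.
  - by [].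
  apply: (K_simpl v) => //; move: Kv; rewrite in_setU => /orP[//|Sv].
  by rewrite S_clique // eq_sym in sv.
move=> SK; have {}SK s k : s \in S -> k \in K -> e s k.
  move=> Ss Kk; apply: contraNT SK => sk; apply/exists_inP; exists s => //.
  by apply/exists_inP; exists k.
have S_simpl v : v \in K -> simplicial_in K v -> simplicial_in (K :|: S) v.
  move=> Kv sv x y; rewrite !in_setU => /orP[Kx|Sx] /orP[Ky|Sy] vx vy xy.
  - exact: sv.
  - by rewrite e_sym SK.
  - exact: SK.
  - exact: S_clique.
case: (boolP [exists k in K, exists k' in K, (k' != k) && ~~ e k k']).
  case/exists_inP=> k Kk /exists_inP[k' Kk' /andP[nk kk']].
  have Kn : #|K| < n by apply: leq_ltn_trans A'n; apply: subset_leq_card; exact: subsetUl.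
  have [v [Kv _ _ sv]] := IH K k k' Kn Kk Kk' nk kk'.
  exact: (K_simpl v) (S_simpl v _ _).
move=> KK; apply: (K_simpl b) => //; apply: S_simpl => // x y Kx Ky _ _ xy.
apply: contraNT KK => exy; apply/exists_inP; exists x => //; apply/exists_inP.
by exists y => //; rewrite eq_sym xy.
Qed.

Lemma C5_exists : 0 < #|T| -> (forall v, ~ simplicial e v) ->
  exists x0 x1 x2 x3 x4, C5 x0 x1 x2 x3 x4.
Proof.
case/card_gt0P=> a _ nsim.
case: (boolP [exists x0, exists x1, exists x2, exists x3, exists x4, C5 x0 x1 x2 x3 x4]).
  by do 5!case/existsP=> ?; move=> C; do 5!eexists; exact: C.
move=> noC; have noC5 : ~ exists x0 x1 x2 x3 x4, C5 x0 x1 x2 x3 x4.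
  move=> [x0 [x1 [x2 [x3 [x4 C]]]]]; move/negP: noC; apply.
  by do 5!(apply/existsP; eexists); exact: C.
(* Since [a] is not simplicial, the graph has two nonadjacent vertices, from which the induction can
   start. *)
case: (nsim a) => x y ax ay xy; case: (boolP (e x y)) => // exy.
have [||||v [_ _ _ sv]] := @chordal_simplicial noC5 setT x y; rewrite ?inE //.
  by rewrite eq_sym.
by case: (nsim v) => z t *; apply: sv; rewrite ?inE.
Qed.

Lemma maxC5_exists : (exists x0 x1 x2 x3 x4, C5 x0 x1 x2 x3 x4) ->
  exists x0 x1 x2 x3 x4, maxC5 x0 x1 x2 x3 x4.
Proof.
case=> x0 [x1 [x2 [x3 [x4 C]]]].
pose P (t : T * T * T * T * T) := let: (a, b, c, d, f) := t in C5 a b c d f.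
pose F (t : T * T * T * T * T) := let: (a, b, c, d, f) := t in #|ring a b c d f|.
have P0 : P (x0, x1, x2, x3, x4) by [].
case: (arg_maxnP F P0) => [[[[[y0 y1] y2] y3] y4] C' M].
exists y0, y1, y2, y3, y4; split=> // z0 z1 z2 z3 z4 Cz.
exact: (M (z0, z1, z2, z3, z4)).
Qed.

Lemma crown_and_universal : 0 < #|T| -> (forall v, ~ simplicial e v) ->
  exists Q : {set T},
    [/\ is_5crown e Q,
        (forall x y, x \in ~: Q -> y \in ~: Q -> x != y -> e x y) &
        complete_to e (~: Q) Q].
Proof.
move=> T0 nsim; have [x0 [x1 [x2 [x3 [x4 M]]]]] := maxC5_exists (C5_exists T0 nsim).
have [C _] := M; exists (ring x0 x1 x2 x3 x4).
have no_outer v : ~~ outer x0 x1 x2 x3 x4 v.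
  by apply/negP=> O; have [u su] := outer_simplicial M O; exact: nsim u su.
split; first exact: ring_crown.
- by move=> x y; rewrite !in_setC => Rx Ry; exact: nonouter_clique C _ Rx _.
- by move=> x y; rewrite !in_setC => Rx; exact: nonouter_cases C _ Rx _.
Qed.

End Ring.

(** * Induced subgraphs of 5-crowns *)

Section Partition.

Variables (A : {set T}) (X : 'I_5 -> {set T}).
Hypothesis RX : ring5_partition e A X.

Lemma part_nbhds i (r := fun u v => cnbhd e A v \subset cnbhd e A u) :
  exists u1 s, [/\ uniq (u1 :: s), (forall x, (x \in u1 :: s) = (x \in X i)),
    X i \subset cnbhd e A (last u1 s),
    cnbhd e A u1 = X (sh i 4) :|: X i :|: X (sh i 1) &
    {in u1 :: s &, forall u v, index u (u1 :: s) <= index v (u1 :: s) -> r u v}].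
Proof.
case: RX => _ _ _ /(_ i)[u1 [s [us mem_s srt Xl Nu]]]; exists u1, s; split=> //.
apply: sorted_leq_index srt => [y x z yx zy|x]; [exact: subset_trans zy yx | exact: subxx].
Qed.

Lemma part_nested i u v : u \in X i -> v \in X i ->
  cnbhd e A u \subset cnbhd e A v \/ cnbhd e A v \subset cnbhd e A u.
Proof.
have [u1 [s [_ mem_s _ _ srt]]] := part_nbhds i; rewrite -!mem_s => Hu Hv.
case: (leqP (index u (u1 :: s)) (index v (u1 :: s))) => [|/ltnW] le.
  by right; exact: srt.
by left; exact: srt.
Qed.

Lemma part_sub i v : v \in X i -> v \in A.
Proof. by case: RX => _ _ <- _ Hv; apply/bigcupP; exists i. Qed.

Lemma part_cover v : v \in A -> exists i, v \in X i.
Proof. by case: RX => _ _ <- _ /bigcupP[i _ Hv]; exists i. Qed.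

Lemma part_inj v i j : v \in X i -> v \in X j -> i = j.
Proof.
case: RX => _ dis _ _ Hi Hj; apply/eqP/negPn/negP => /dis /pred0P/(_ v) /=.
by rewrite Hi Hj.
Qed.

(** The last vertex of the ordering has the least neighbourhood, and even that contains the whole
    part. *)
Lemma part_clique i u v : u \in X i -> v \in X i -> u != v -> e u v.
Proof.
have [u1 [s [us mem_s Xl _ srt]]] := part_nbhds i; move=> Hu Hv uv.
have lu : cnbhd e A (last u1 s) \subset cnbhd e A u.
  apply: srt; rewrite ?mem_s ?mem_last //; first by rewrite -mem_s mem_last.
  by rewrite index_last // -ltnS index_mem mem_s.
have := subsetP lu v (subsetP Xl v Hv); rewrite inE => /andP[_].
by rewrite eq_sym (negbTE uv).
Qed.

Lemma part_top i : exists2 u, u \in X i &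
  cnbhd e A u = X (sh i 4) :|: X i :|: X (sh i 1) /\
  {in X i, forall v, cnbhd e A v \subset cnbhd e A u}.
Proof.
have [u1 [s [_ mem_s _ Nu srt]]] := part_nbhds i.
exists u1; first by rewrite -mem_s mem_head.
by split=> // v; rewrite -mem_s => Hv; apply: srt; rewrite ?mem_head //= eqxx.
Qed.

Lemma part_edge i j u v : u \in X i -> v \in X j -> e u v ->
  [|| j == sh i 4, j == i | j == sh i 1].
Proof.
move=> Hu Hv uv; have [w _ [Nw /(_ _ Hu) /subsetP/(_ v)]] := part_top i.
rewrite {}Nw [v \in cnbhd _ _ _]inE (part_sub Hv) uv orbT => /(_ isT).
by rewrite !in_setU => /orP[/orP[]|] /(part_inj Hv) ->; rewrite eqxx ?orbT.
Qed.

(** The first vertices of the two neighbouring parts both see [v], but not each other, since their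
    parts are not consecutive. *)
Lemma part_no_simplicial v : v \in A -> ~ simplicial e v.
Proof.
case/part_cover=> i Hv sv.
have E4 : sh (sh i 4) 1 = i.
  apply: val_inj; rewrite /= /sh !inordK ?ltn_pmod // modnDml -addnA.
  by rewrite modnDr modn_small.
have E1 : sh (sh i 1) 4 = i.
  apply: val_inj; rewrite /= /sh !inordK ?ltn_pmod // modnDml -addnA.
  by rewrite modnDr modn_small.
have [u4 H4 [N4 _]] := part_top (sh i 4); have [u1 H1 [N1 _]] := part_top (sh i 1).
have neq_sh j k : v \in X i -> j \in X k -> k != i -> v != j.
  move=> _ Hj; apply: contraNneq => vj; rewrite -vj in Hj; apply/eqP; exact: part_inj Hj Hv.
have ne4 : sh i 4 != i by case: (i) => [[|[|[|[|[|?]]]]] ?] //; rewrite -val_eqE /= inordK.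
have ne1 : sh i 1 != i by case: (i) => [[|[|[|[|[|?]]]]] ?] //; rewrite -val_eqE /= inordK.
have vu4 : e v u4.
  have : v \in cnbhd e A u4 by rewrite N4 E4 !in_setU Hv ?orbT.
  by rewrite inE e_sym (negbTE (neq_sh _ _ Hv H4 ne4)) => /andP[].
have vu1 : e v u1.
  have : v \in cnbhd e A u1 by rewrite N1 E1 !in_setU Hv ?orbT.
  by rewrite inE e_sym (negbTE (neq_sh _ _ Hv H1 ne1)) => /andP[].
have ne41 : sh i 4 != sh i 1.
  by case: (i) => [[|[|[|[|[|?]]]]] ?] //; rewrite -val_eqE /= !inordK.
have u41 : u4 != u1.
  apply: contraNneq ne41 => E; rewrite E in H4; apply/eqP; exact: part_inj H4 H1.
have := part_edge H4 H1 (sv _ _ vu4 vu1 u41).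
by case: (i) => [[|[|[|[|[|?]]]]] ?] //; rewrite -!val_eqE /= !inordK ?ltn_pmod.
Qed.

End Partition.

(** * Induced subgraphs as colourings by Z/5 *)

Definition near5 a b := [|| b == (a + 4) %% 5, b == a | b == (a + 1) %% 5].

(* The colourings of 0, ..., n - 1 with five colours all of whose pairs
   (x, colour of x), (y, colour of y) satisfy ok. *)
Fixpoint colourings (ok : nat -> nat -> nat -> nat -> bool) n :=
  if n is m.+1 then
    [seq t <- [seq rcons s a | s <- colourings ok m, a <- iota 0 5] |
      all (fun x => ok x m (nth 0 t x) (nth 0 t m) && ok m x (nth 0 t m) (nth 0 t x))
        (iota 0 m.+1)]
  else [:: [::]].

(** The search is exhaustive although each extension tests only the pairs that involve the new
    vertex: the other pairs were tested at earlier stages. *)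
Lemma mem_colourings (ok : nat -> nat -> nat -> nat -> bool) n (c : nat -> nat) :
  (forall x, x < n -> c x < 5) ->
  (forall x y, x < n -> y < n -> ok x y (c x) (c y)) -> mkseq c n \in colourings ok n.
Proof.
elim: n => // n IH c5 okc; rewrite mkseqS.
have {}IH : mkseq c n \in colourings ok n.
  by apply: IH => [x xn | x y xn yn]; [apply: c5 | apply: okc]; apply: leqW.
suff : rcons (mkseq c n) (c n) \in
    [seq t <- [seq rcons s a | s <- colourings ok n, a <- iota 0 5] |
      all (fun x => ok x n (nth 0 t x) (nth 0 t n) && ok n x (nth 0 t n) (nth 0 t x))
        (iota 0 n.+1)] by [].
rewrite mem_filter; apply/andP; split; last first.
  by apply/allpairsP; exists (mkseq c n, c n); rewrite IH mem_iota c5.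
apply/allP=> x; rewrite mem_iota add0n /= => xn.
by rewrite -mkseqS !nth_mkseq // !okc.
Qed.

Lemma colouring_search n (p : 'I_n -> 'I_5) (ok : nat -> nat -> nat -> nat -> bool) :
  (forall x y : 'I_n, ok x y (p x) (p y)) -> colourings ok n != [::].
Proof.
move=> okp; pose c x := if insub x is Some i then val (p i) else 0.
have cE x (xn : x < n) : c x = p (Ordinal xn) by rewrite /c insubT.
have : mkseq c n \in colourings ok n.
  apply: mem_colourings => [x xn | x y xn yn]; rewrite !cE; first exact: ltn_ord.
  exact: okp (Ordinal xn) (Ordinal yn).
by case: (colourings ok n).
Qed.

(** Adjacent vertices never have nested closed neighbourhoods. As vertices in one part of a ring do,
    an induced copy of such a graph meets each part at most once. *)
Definition incomparable (H : finType) (h : rel H) :=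
  forall x y, x != y -> h x y -> exists z, [&& z != y, ~~ h y z & (z == x) || h x z].

Section Colouring.

Variables (A : {set T}) (X : 'I_5 -> {set T}) (RX : ring5_partition e A X).
Variables (H : finType) (h : rel H) (f : H -> T).
Hypotheses (f_inj : injective f) (fh : forall x y, e (f x) (f y) = h x y).
Hypothesis fA : forall x, f x \in A.

(** The default [ord0] is never taken, because the parts cover [A]. *)
Definition colour x : 'I_5 := odflt ord0 [pick i | f x \in X i].

Lemma colourP x : f x \in X (colour x).
Proof.
rewrite /colour; case: pickP => //= noi.
by have [i] := part_cover RX (fA x); rewrite noi.
Qed.

Lemma colour_clique x y : x != y -> colour x = colour y -> h x y.
Proof.
move=> xy cxy; rewrite -fh; apply: (part_clique RX (colourP x)).
  by rewrite cxy colourP.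
by rewrite (inj_eq f_inj).
Qed.

Lemma colour_near x y : h x y -> near5 (colour x) (colour y).
Proof.
rewrite -fh => xy; have := part_edge RX (colourP x) (colourP y) xy.
by rewrite /near5 -!val_eqE /= !inordK ?ltn_pmod.
Qed.

Lemma colour_inj : incomparable h -> injective colour.
Proof.
move=> inc x y cxy; apply/eqP/negPn/negP => xy; have yx : y != x by rewrite eq_sym.
have hxy := colour_clique xy cxy; have hyx := colour_clique yx (esym cxy).
have Yx := colourP x; rewrite cxy in Yx.
have sep u v : u != v -> h u v -> ~ (cnbhd e A (f u) \subset cnbhd e A (f v)).
  move=> uv /(inc _ _ uv)[z /and3P[zv vz uz]] /subsetP/(_ (f z)).
  rewrite !inE fA !fh !(inj_eq f_inj) uz (negbTE zv) (negbTE vz) /=.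
  by move/(_ isT).
by case: (part_nested RX Yx (colourP y)) => [/(sep _ _ xy hxy)|/(sep _ _ yx hyx)].
Qed.

End Colouring.

Lemma crown_colouring A (H : finType) (h : rel H) (f : H -> T) :
  is_5crown e A -> injective f -> (forall x y, e (f x) (f y) = h x y) ->
  (forall x, f x \in A) ->
  exists (p : H -> 'I_5) (i : 'I_5),
    [/\ forall x y, x != y -> p x = p y -> h x y,
        forall x y, h x y -> near5 (p x) (p y),
        incomparable h -> injective p,
        (forall x y, p x = sh i 4 -> p y = sh i 3 -> h x y) &
        (forall x y, p x = sh i 1 -> p y = sh i 2 -> h x y)].
Proof.
move=> [X [RX [i [c43 c12]]]] f_inj fh fA; exists (colour X f), i; split.
- exact: (colour_clique RX).
- exact: (colour_near RX).
- exact: (colour_inj RX).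
- move=> x y px py; rewrite -fh; apply: c43; rewrite -?px -?py; exact: (colourP RX).
- move=> x y px py; rewrite -fh; apply: c12; rewrite -?px -?py; exact: (colourP RX).
Qed.

(** * Absence of the forbidden subgraphs after adding universal vertices *)

Section CrownPlusUniversal.

Variable Q : {set T}.
Hypotheses (crownQ : is_5crown e Q)
  (outK : forall x y, x \in ~: Q -> y \in ~: Q -> x != y -> e x y)
  (outQ : complete_to e (~: Q) Q).

Lemma universal x y : x \notin Q -> x != y -> e x y.
Proof.
by move=> Qx xy; case: (boolP (y \in Q)) => Qy;
  [apply: outQ | apply: outK]; rewrite ?inE.
Qed.

Lemma induced_in_crown (H : finType) (h : rel H) (f : H -> T) :
  injective f -> (forall x y, e (f x) (f y) = h x y) ->
  (forall x, exists2 y, x != y & ~~ h x y) -> forall x, f x \in Q.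
Proof.
move=> f_inj fh nu x; have [y xy] := nu x; rewrite -fh; apply: contraR => Qx.
by apply: universal => //; rewrite (inj_eq f_inj).
Qed.

(** By pigeonhole on the five parts. *)
Lemma crown_few n (h : rel 'I_n) : 5 < n -> incomparable h ->
  (forall x, exists2 y, x != y & ~~ h x y) -> ~ has_induced e h.
Proof.
move=> n5 inc nu [f [f_inj fh]].
have [p [i [_ _ pinj _ _]]] := crown_colouring crownQ f_inj fh (induced_in_crown f_inj fh nu).
by have := leq_card p (pinj inc); rewrite !card_ord leqNgt n5.
Qed.

Lemma ord_check n (P : nat -> nat -> nat -> bool) :
  all (fun x => all (fun y => has (P x y) (iota 0 n)) (iota 0 n)) (iota 0 n) ->
  forall x y : 'I_n, exists z : 'I_n, P x y z.
Proof.
move=> chk x y; have In (z : 'I_n) : val z \in iota 0 n by rewrite mem_iota add0n /=.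
have /hasP[z] := allP (allP chk _ (In x)) _ (In y).
by rewrite mem_iota add0n /= => zn Pz; exists (Ordinal zn).
Qed.

Lemma incomparable_check n (h : rel 'I_n) (g : nat -> nat -> bool) :
  (forall x y, h x y = g x y) ->
  all (fun x => all (fun y => has (fun z => (x != y) && g x y ==>
    [&& z != y, ~~ g y z & (z == x) || g x z]) (iota 0 n)) (iota 0 n)) (iota 0 n) ->
  incomparable h.
Proof.
move=> hg /ord_check chk x y xy hxy; have [z] := chk x y.
by rewrite -!hg hxy !val_eqE xy => ?; exists z.
Qed.

Lemma nonuniversal_check n (h : rel 'I_n) (g : nat -> nat -> bool) :
  (forall x y, h x y = g x y) ->
  all (fun x => all (fun y => has (fun z => (x != z) && ~~ g x z)
    (iota 0 n)) (iota 0 n)) (iota 0 n) ->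
  forall x, exists2 y, x != y & ~~ h x y.
Proof.
(* The second variable of [ord_check] is a dummy here. *)
move=> hg /ord_check chk x; have [z] := chk x x.
by rewrite -hg val_eqE => /andP[? ?]; exists z.
Qed.

Definition cycle_nat k i j := (j == i.+1 %% k) || (i == j.+1 %% k).

Definition twoP3_nat i j :=
  ((i %/ 3) == (j %/ 3)) && ((i.+1 == j) || (j.+1 == i)).

Lemma crown_C6 : ~ has_induced e (@cycle_rel 6).
Proof.
apply: crown_few => //; first exact: (@incomparable_check _ _ (cycle_nat 6)).
exact: (@nonuniversal_check _ _ (cycle_nat 6)).
Qed.

Lemma crown_C7 : ~ has_induced e (@cycle_rel 7).
Proof.
apply: crown_few => //; first exact: (@incomparable_check _ _ (cycle_nat 7)).
exact: (@nonuniversal_check _ _ (cycle_nat 7)).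
Qed.

Lemma crown_pent3 : ~ has_induced e pent3_rel.
Proof.
pose g i j := pent3_half i j || pent3_half j i.
apply: crown_few => //; first exact: (@incomparable_check _ _ g).
exact: (@nonuniversal_check _ _ g).
Qed.

Lemma crown_C4 : ~ has_induced e (@cycle_rel 4).
Proof.
move=> [f [f_inj fh]].
have nu := @nonuniversal_check 4 (@cycle_rel 4) (cycle_nat 4) (fun _ _ => erefl) isT.
have inc := @incomparable_check 4 (@cycle_rel 4) (cycle_nat 4) (fun _ _ => erefl) isT.
have [p [_ [_ near pinj _ _]]] :=
  crown_colouring crownQ f_inj fh (induced_in_crown f_inj fh nu).
(* Four vertices fit into five parts, so pigeonhole does not suffice. The search confirms that Z/5
   has no 4-cycle on distinct parts. *)
pose ok x y a b := ((x != y) ==> (a != b)) && (cycle_nat 4 x y ==> near5 a b).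
have okp (x y : 'I_4) : ok x y (p x) (p y).
  apply/andP; split; apply/implyP; last exact: near.
  by rewrite !val_eqE (inj_eq (pinj inc)).
by have := colouring_search okp.
Qed.

(** The closed neighbourhood of an end of a P3 lies in that of its centre, so a part may be met
    twice. It is here that the complete pairs of the crown are used. *)
Lemma crown_twoP3 : ~ has_induced e twoP3_rel.
Proof.
move=> [f [f_inj fh]].
have nu := @nonuniversal_check 6 twoP3_rel twoP3_nat (fun _ _ => erefl) isT.
have [p [i [cl near _ c43 c12]]] :=
  crown_colouring crownQ f_inj fh (induced_in_crown f_inj fh nu).
pose ok i x y a b := [&& (x != y) && (a == b) ==> twoP3_nat x y,
  twoP3_nat x y ==> near5 a b,
  (a == (i + 4) %% 5) && (b == (i + 3) %% 5) ==> twoP3_nat x y &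
  (a == (i + 1) %% 5) && (b == (i + 2) %% 5) ==> twoP3_nat x y].
have p_sh (x : 'I_6) k : (p x == (i + k) %% 5 :> nat) -> p x = sh i k.
  by move=> /eqP px; apply: val_inj; rewrite /= inordK ?ltn_pmod.
have okp (x y : 'I_6) : ok i x y (p x) (p y).
  apply/and4P; split; apply/implyP.
  - by rewrite !val_eqE => /andP[xy /eqP]; exact: cl.
  - exact: near.
  - by case/andP=> /p_sh px /p_sh py; exact: c43.
  - by case/andP=> /p_sh px /p_sh py; exact: c12.
by have := colouring_search okp; case: (i) => [[|[|[|[|[|?]]]]] ?].
Qed.

Lemma crown_no_simplicial v : ~ simplicial e v.
Proof.
have [X [RX _]] := crownQ; case: (boolP (v \in Q)) => Qv.
  exact: (part_no_simplicial RX Qv).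
have [u0 H0 _] := part_top RX ord0; have [u2 H2 _] := part_top RX (inord 2).
have vQ u i : u \in X i -> e v u.
  by move=> Hu; apply: outQ; rewrite ?inE // (part_sub RX Hu).
have u02 : u0 != u2.
  apply/eqP => E; rewrite E in H0; have := part_inj RX H0 H2.
  by move/(congr1 val); rewrite /= inordK.
move/(_ u0 u2 (vQ _ _ H0) (vQ _ _ H2) u02) => /(part_edge RX H0 H2).
by rewrite -!val_eqE /= !inordK ?ltn_pmod.
Qed.

End CrownPlusUniversal.

(** * Anticomponents *)

Lemma connect_corel_step B x y : connect (corel e B) x y -> x != y ->
  exists2 z, z != x & ~~ e x z.
Proof.
case/connectP=> [[|z p] /= ] => [_ -> | /andP[/and4P[_ _ xz exz] _] _ _].
  by rewrite eqxx.
by exists z; rewrite // eq_sym.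
Qed.

(** A vertex outside [Q] is universal, hence isolated in the complement. *)
Lemma coconnected_sub (Q B : {set T}) : coconnected e B -> 1 < #|B| ->
  (forall x y, x \notin Q -> x != y -> e x y) -> B \subset Q.
Proof.
move=> [_ cB] B1 univ; apply/subsetP=> x Bx; apply: contraTT B1 => Qx.
have Bx1 : B \subset [set x].
  apply/subsetP=> y By; rewrite inE; apply: contraT; rewrite eq_sym => xy.
  have [z zx /negP[]] := connect_corel_step (cB x y Bx By) xy.
  by apply: univ; rewrite // eq_sym.
by rewrite -leqNgt -(cards1 x) subset_leq_card.
Qed.

(** In the complement, parts two steps apart are completely joined, and steps of two lead from any
    part to any other in Z/5. At least one step is taken, so that two vertices of the same part are
    joined by going all the way round. *)
Lemma crown_coconnected Q : is_5crown e Q -> coconnected e Q /\ 1 < #|Q|.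
Proof.
move=> [X [RX _]].
have step i x y : x \in X i -> y \in X (sh i 2) -> connect (corel e Q) x y.
  move=> Hx Hy; apply: connect1; rewrite /corel (part_sub RX Hx) (part_sub RX Hy) /=.
  have sh2 : [|| sh i 2 == sh i 4, sh i 2 == i | sh i 2 == sh i 1] = false.
    by case: (i) => [[|[|[|[|[|?]]]]] ?] //; rewrite -!val_eqE /= !inordK ?ltn_pmod.
  apply/andP; split; last first.
    by apply/negP => /(part_edge RX Hx Hy); rewrite sh2.
  apply/eqP => xy; rewrite -xy in Hy; move: sh2.
  by rewrite (part_inj RX Hy Hx) eqxx orbT.
have walk k i x y : x \in X i -> y \in X (iter k.+1 (fun j => sh j 2) i) ->
    connect (corel e Q) x y.
  elim: k y => [|k IH] y Hx Hy; first exact: step Hx Hy.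
  have [u Hu _] := part_top RX (iter k.+1 (fun j => sh j 2) i).
  by apply: connect_trans (IH u Hx Hu) (step _ _ _ Hu Hy).
have reach (i j : 'I_5) : exists k, j = iter k.+1 (fun j => sh j 2) i.
  have val_it k : val (iter k (fun j => sh j 2) i) = (i + k * 2) %% 5.
    elim: k => [|k IH]; first by rewrite addn0 modn_small.
    by rewrite iterS /= inordK ?ltn_pmod // IH modnDml -addnA mulSn addnC [2 + _]addnC addnC.
  (* As 3 inverts 2 modulo 5, [k + 1] must be congruent to [3 * (j - i)]. The 5 avoids truncated
     subtraction, and 4 stands for -1. *)
  pose k := (3 * (j + 5 - i) + 4) %% 5; exists k; apply: val_inj; rewrite val_it /k.
  by case: (i) => [[|[|[|[|[|?]]]]] ?] //; case: (j) => [[|[|[|[|[|?]]]]] ?].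
have [x0 H0 _] := part_top RX ord0; have [x2 H2 _] := part_top RX (inord 2).
have Q0 := part_sub RX H0; have Q2 := part_sub RX H2.
split.
  split; first by apply/set0Pn; exists x0.
  move=> x y /(part_cover RX)[i Hx] /(part_cover RX)[j Hy].
  by have [k jk] := reach i j; apply: (walk k i) => //; rewrite -jk.
apply/card_gt1P; exists x0, x2; split=> //; apply/eqP => E; rewrite E in H0.
by have := congr1 val (part_inj RX H0 H2); rewrite /= inordK.
Qed.

Lemma crown_is_anticomponent (Q : {set T}) : is_5crown e Q ->
  (forall x y, x \notin Q -> x != y -> e x y) ->
  [/\ anticomponent e Q, 1 < #|Q| &
      forall B : {set T}, anticomponent e B -> 1 < #|B| -> B = Q].
Proof.
move=> crQ univ; have [cQ Q1] := crown_coconnected crQ; split=> //.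
  split=> // B QB cB; apply/eqP; rewrite eqEsubset QB andbT.
  by apply: coconnected_sub univ => //; apply: leq_trans Q1 (subset_leq_card QB).
move=> B [cB maxB] B1; apply/esym/maxB => //; exact: coconnected_sub univ.
Qed.

Lemma coconnected_extend B : coconnected e B ->
  exists2 A, anticomponent e A & B \subset A.
Proof.
pose cob (A : {set T}) := (A != set0) &&
  [forall x in A, forall y in A, connect (corel e A) x y].
have cobP A : reflect (coconnected e A) (cob A).
  apply: (iffP andP) => -[A0 cA]; split=> //.
    by move=> x y Ax Ay; exact: (forall_inP (forall_inP cA x Ax)).
  by apply/forall_inP => x Ax; apply/forall_inP => y Ay; exact: cA.
move=> /cobP /maxset_exists[A /maxsetP[/cobP cA maxA] BA]; exists A => //.
by split=> // D AD /cobP cD; exact: maxA.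
Qed.

Lemma nonedge_coconnected x y : x != y -> ~~ e x y -> coconnected e [set x; y].
Proof.
move=> xy exy; split; first by apply/set0Pn; exists x; rewrite !inE eqxx.
have xyc : connect (corel e [set x; y]) x y.
  by apply: connect1; rewrite /corel !inE !eqxx orbT xy exy.
have yxc : connect (corel e [set x; y]) y x.
  by apply: connect1; rewrite /corel !inE !eqxx orbT (eq_sym y x) xy e_sym exy.
move=> u v; rewrite !inE => /orP[] /eqP-> /orP[] /eqP-> //; exact: connect0.
Qed.

(** A non-edge is coconnected, so it extends to a nontrivial anticomponent, which can only be
    [A]. *)
Lemma unique_anticomponent_universal (A : {set T}) :
  (forall B : {set T}, anticomponent e B -> 1 < #|B| -> B = A) ->
  forall x y, x \notin A -> x != y -> e x y.
Proof.
move=> uA x y Ax xy; apply: contraNT Ax => exy.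
have [B aB sB] := coconnected_extend (nonedge_coconnected xy exy).
rewrite -(uA B) //; last by apply: leq_trans (subset_leq_card sB); rewrite cards2 xy.
by apply: (subsetP sB); rewrite !inE eqxx.
Qed.

End Graph.

Theorem theorem6p9 (T : finType) (e : rel T)
  (e_sym : symmetric e) (e_irr : irreflexive e) (T_nonnull : 0 < #|T|) :
  [<-> (* (a) *)
       (~ has_induced e twoP3_rel /\ ~ has_induced e (@cycle_rel 4) /\
        ~ has_induced e (@cycle_rel 6) /\ ~ has_induced e (@cycle_rel 7) /\
        ~ has_induced e pent3_rel /\ (forall v : T, ~ simplicial e v));
       (* (b) *)
       (exists A : {set T},
          [/\ anticomponent e A, 1 < #|A|, is_5crown e A &
              forall B : {set T}, anticomponent e B -> 1 < #|B| -> B = A]);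
       (* (c) *)
       (exists Q : {set T},
          [/\ is_5crown e Q,
              (forall x y, x \in ~: Q -> y \in ~: Q -> x != y -> e x y) &
              complete_to e (~: Q) Q])].
Proof.
tfae.
- case=> P3 [c4 [c6 [c7 [p3 nsim]]]].
  (* The decomposition of (c) is obtained first; (b) follows because the crown is coconnected and
     all other vertices are universal. *)
  have [Q [crQ outK outQ]] := crown_and_universal e_sym e_irr (twoP3_freeP e_sym e_irr P3)
    (C4_freeP e_sym e_irr c4) (C6_freeP e_sym e_irr c6) (C7_freeP e_sym e_irr c7)
    (pent3_freeP e_sym e_irr p3) T_nonnull nsim.
  have [aQ Q1 uQ] := crown_is_anticomponent crQ (universal outK outQ).
  by exists Q.
- case=> A [_ _ crA uA]; exists A; have univ := unique_anticomponent_universal e_sym uA.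
  split=> // x y; rewrite !inE => Ax; first by move=> _; exact: univ.
  by move=> Ay; apply: univ => //; apply: contraNneq Ax => ->.
- case=> Q [crQ outK outQ]; do ![split].
  + exact: crown_twoP3 crQ outK outQ.
  + exact: crown_C4 crQ outK outQ.
  + exact: crown_C6 crQ outK outQ.
  + exact: crown_C7 crQ outK outQ.
  + exact: crown_pent3 crQ outK outQ.
  + by move=> v; apply: (crown_no_simplicial e_sym crQ outQ).
Qed.
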